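(* Work in the polyhedral setting described in the context. Let $y^0\in X^m$, and for $k=1,2,\dots$ let $y^k$ be the output of one cycle of the algorithm with input $y^{k-1}$. Suppose the cycles are run so that: (1) for all $i\in[1,m]$, if $i\in Q_j$, then the polyhedra $P_{i,j}$ are chosen to be the intersection of halfspaces that were produced by the projection process so far; (2) the cycle lengths $w'$ over all cycles are uniformly bounded by some $w$. Then, for the given instance (the sets $C_i$ and the point $d$) and the given starting point $y^0$, there are $\delta_2>0$, $\bar k>0$ and $\rho\in[0,1)$ such that (A) if $k<\bar k$, then $v(y^k)<v(y^{k-1})-\delta_2$; and (B) if $k>\bar k$, then $v(y^k)\le\rho\,v(y^{k-1})$.
   Context: $[a,b]$ denotes the integers from $a$ to $b$. $P_D$ is the projection onto a closed convex set $D$, and $\delta^*(z,D)=\sup_{x\in D}\langle z,x\rangle$. Polyhedral setting. $X$ is a real Hilbert space. For $i\in[1,m]$, $r\in[1,K]$ let $f_{i,r}\in X$ be unit vectors, $c_{i,r}\in\mathbb R\cup\{\infty\}$, $\mathcal H_{i,r}=\{x:\langle x,f_{i,r}\rangle\le c_{i,r}\}$ ($=X$ if $c_{i,r}=\infty$), $C_i=\bigcap_{r=1}^K\mathcal H_{i,r}$, $C=\bigcap_{i=1}^m C_i\ne\emptyset$. Let $d\in X$ with $P_C(d)=0$. The problem being solved is to minimize $\frac12\|x-d\|^2$ over $x\in C$. Dual function: $v(y)=\frac12\|d-\sum_{i=1}^m y_i\|^2+\sum_{i=1}^m\delta^*(y_i,C_i)$ for $y\in X^m$. One cycle of the algorithm.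 Input $y^\circ\in X^m$, output $y^+\in X^m$. Choose an integer $w'\ge m$ (the cycle length) and $s:[1-m,w']\to[1,m]$ with $s(i-m)=i$ for $i\in[1,m]$ and $\{s(1),\dots,s(w')\}=[1,m]$. For $j\in[0,w']$, $i\in[1,m]$ put $\pi(j,i)=\max\{j'\le j:s(j')=i\}$, and for $j\in[1,w']$ put $p(j)=\pi(j-1,s(j))$. Set $e_{i-m,1}=y_i^\circ$ and $x_0^+=d-\sum_i y_i^\circ$. For $j=1,\dots,w'$: (a) (projection) $z_j=x_{j-1}^++e_{p(j),j}$, $x_j^\circ=P_{C_{s(j)}}(z_j)$, $e_{j,j}=z_j-x_j^\circ$ (note $\pi(j,s(j))=j$ and $\pi(j,i)=\pi(j-1,i)$ for $i\ne s(j)$). Such a projection onto $C_{s(j)}$ produces a supporting halfspace of $C_{s(j)}$, namely $\{x:\langle z_j-x_j^\circ,x-x_j^\circ\rangle\le0\}$. (b) (SHQP step) Choose any $Q_j\subset[1,m]$ (possibly empty) and, for $i\in Q_j$, polyhedra $P_{i,j}\supset C_i$ with $\delta^*(e_{\pi(j,i),j},P_{i,j})=\delta^*(e_{\pi(j,i),j},C_i)$. Put $e_{\pi(j,i),j+1}=e_{\pi(j,i),j}$ for $i\notin Q_j$, and let $(e_{\pi(j,i),j+1})_{i\in Q_j}$ be a minimizer over $(\tilde y_i)_{i\in Q_j}$ of $\frac12\|d-\sum_{i\notin Q_j}e_{\pi(j,i),j}-\sum_{i\in Q_j}\tilde y_i\|^2+\sum_{i\in Q_j}\delta^*(\tilde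 y_i,P_{i,j})$. Put $x_j^+=d-\sum_{i=1}^m e_{\pi(j,i),j+1}$. Finally $y_i^+=e_{\pi(w',i),w'+1}$. The choices of $w'$, $s$, $Q_j$, $P_{i,j}$ may differ from cycle to cycle.
   Formalization: In (1), ''produced by the projection process so far'' is taken to mean produced by the projections at steps 1,…,j of the current cycle; if halfspaces from earlier cycles may be reused, the claim fails, since v(y^k)/v(y^{k-1}) can approach 1 along infinitely many cycles. *)

(* Defs.v *)
From HB Require Import structures.
From mathcomp Require Import all_boot all_order all_algebra.
From mathcomp Require Import all_classical all_reals all_analysis.

Set Implicit Arguments.
Unset Strict Implicit.
Unset Printing Implicit Defensive.

Import Order.TTheory GRing.Theory Num.Theory.
Import numFieldNormedType.Exports.

Local Open Scope classical_set_scope.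
Local Open Scope ring_scope.

(* Library: MathComp-Analysis.

   A real Hilbert space is rendered as a complete normed module X over a
   realType R, with a positive definite symmetric bilinear form
   ip : {dot X for idfun} satisfying `|x| ^+ 2 = ip x x; that equation is a
   hypothesis of the theorem.

   The index ranges [1,m] and [1,K] are 'I_m and 'I_K, shifted to start at 0.
   Positions in a cycle keep their original numbering: they are integers in
   [1 - m, w'], so the paper's s(i - m) = i for i in [1,m] reads
   s (i.+1 - m) = i for i : 'I_m. *)

Section Geometry.
Variables (R : realType) (X : completeNormedModType R) (ip : {dot X for idfun}).

Definition halfspace (a : X) (b : \bar R) : set X :=
  [set x | ((ip x a)%:E <= b)%E].

Definition is_polyhedron (P : set X) : Prop :=
  exists (N : nat) (a : 'I_N -> X) (b : 'I_N -> R),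
    P = \bigcap_(l in [set: 'I_N]) halfspace (a l) (b l)%:E.

(* p = P_D(z); for D closed convex and nonempty, p is unique *)
Definition is_projection (D : set X) (z p : X) : Prop :=
  D p /\ forall q, D q -> `|z - p| <= `|z - q|.

(* delta^*(z, D) *)
Definition support_fun (z : X) (D : set X) : \bar R :=
  ereal_sup [set (ip z x)%:E | x in D].

Section Polyhedra.
Variables (m K : nat) (f : 'I_m -> 'I_K -> X) (c : 'I_m -> 'I_K -> \bar R).

Definition Cset (i : 'I_m) : set X :=
  \bigcap_(r in [set: 'I_K]) halfspace (f i r) (c i r).

Definition Cinter : set X := \bigcap_(i in [set: 'I_m]) Cset i.

End Polyhedra.

Section Algorithm.
Variables (m : nat) (C : 'I_m -> set X) (d : X).

Definition dual_fun (y : 'I_m -> X) : \bar R :=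
  ((2^-1 * `|d - \sum_(i < m) y i| ^+ 2)%:E
   + \sum_(i < m) support_fun (y i) (C i))%E.

(* The choices made in one cycle, and the vectors it computes.  Only the
   values at the positions and steps occurring in [cycle_spec] matter. *)
Record shqp_cycle := ShqpCycle {
  cyc_len : nat;                          (* w' *)
  cyc_s : int -> 'I_m;
  cyc_Q : nat -> {set 'I_m};              (* j |-> Q_j *)
  cyc_P : 'I_m -> nat -> set X;           (* i, j |-> P_{i,j} *)
  cyc_e : int -> nat -> X;                (* l, j |-> e_{l,j} *)
  cyc_proj : nat -> X                     (* j |-> x_j^o *)
}.

(* pi(j,i) = max {j' in [1 - m, j] : s j' = i}, with j' = 1 - m + t *)
Definition last_pos (s : int -> 'I_m) (j : nat) (i : 'I_m) : int :=
  \big[Order.max/(1 - m%:Z)]_(0 <= t < m + j | s (1 - m%:Z + t%:Z) == i)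
     (1 - m%:Z + t%:Z).

Section Cycle.
Variable cy : shqp_cycle.
Let s := cyc_s cy.
Let e := cyc_e cy.

(* x_j^+; for j = 0 this is d - \sum_i y^o_i, as pi(0,i) = i - m *)
Definition cyc_x (j : nat) : X :=
  d - \sum_(i < m) e (last_pos s j i) j.+1.

(* z_j = x_{j-1}^+ + e_{p(j),j}, where p(j) = pi(j-1,s(j)) *)
Definition cyc_z (j : nat) : X :=
  cyc_x j.-1 + e (last_pos s j.-1 (s j%:Z)) j.

Definition shqp_obj (j : nat) (u : 'I_m -> X) : \bar R :=
  ((2^-1 * `|d - \sum_(i < m | i \notin cyc_Q cy j) e (last_pos s j i) j
              - \sum_(i < m | i \in cyc_Q cy j) u i| ^+ 2)%:E
   + \sum_(i < m | i \in cyc_Q cy j) support_fun (u i) (cyc_P cy i j))%E.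

Definition produced_halfspace (j : nat) : set X :=
  [set x | ip (cyc_z j - cyc_proj cy j) (x - cyc_proj cy j) <= 0].

Record projection_step (j : nat) : Prop := {
  proj_stepP : is_projection (C (s j%:Z)) (cyc_z j) (cyc_proj cy j);
  proj_step_e : e j%:Z j = cyc_z j - cyc_proj cy j
}.

Record shqp_step (j : nat) : Prop := {
  shqp_polyhedron : forall i, i \in cyc_Q cy j -> is_polyhedron (cyc_P cy i j);
  shqp_sup : forall i, i \in cyc_Q cy j -> C i `<=` cyc_P cy i j;
  shqp_support : forall i, i \in cyc_Q cy j ->
    support_fun (e (last_pos s j i) j) (cyc_P cy i j)
      = support_fun (e (last_pos s j i) j) (C i);
  shqp_keep : forall i, i \notin cyc_Q cy j ->
    e (last_pos s j i) j.+1 = e (last_pos s j i) j;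
  shqp_min : forall u : 'I_m -> X,
    (shqp_obj j (fun i => e (last_pos s j i) j.+1) <= shqp_obj j u)%E
}.

(* cy is a cycle of the algorithm with input yin and output yout *)
Record cycle_spec (yin yout : 'I_m -> X) : Prop := {
  cycle_len : (m <= cyc_len cy)%N;
  cycle_s_init : forall i : 'I_m, s (i.+1%:Z - m%:Z) = i;
  cycle_s_onto : forall i : 'I_m,
    exists j : nat, (1 <= j <= cyc_len cy)%N /\ s j%:Z = i;
  cycle_input : forall i : 'I_m, e (i.+1%:Z - m%:Z) 1%N = yin i;
  cycle_projection : forall j, (1 <= j <= cyc_len cy)%N -> projection_step j;
  cycle_shqp : forall j, (1 <= j <= cyc_len cy)%N -> shqp_step j;
  cycle_output : forall i : 'I_m,
    yout i = e (last_pos s (cyc_len cy) i) (cyc_len cy).+1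
}.

(* A cycle carries nothing over from earlier cycles but its input, so the
   halfspaces available at step j are those produced by steps 1, ..., j of
   this cycle. *)
Definition uses_produced_halfspaces : Prop :=
  forall (j : nat) (i : 'I_m),
    (1 <= j <= cyc_len cy)%N -> i \in cyc_Q cy j ->
    exists J : set nat, (forall l, J l -> (1 <= l <= j)%N) /\
      cyc_P cy i j = \bigcap_(l in J) produced_halfspace l.

End Cycle.

End Algorithm.

End Geometry.

(* Main.v *)
Require Import Defs.
From HB Require Import structures.
From mathcomp Require Import all_boot all_order all_algebra.
From mathcomp Require Import all_classical all_reals all_analysis.
From mathcomp Require Import ring lra zify.

Set Implicit Arguments.
Unset Strict Implicit.
Unset Printing Implicit Defensive.

Import Order.TTheory GRing.Theory Num.Theory.
Import numFieldNormedType.Exports.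

Local Open Scope classical_set_scope.
Local Open Scope ring_scope.

(* Each projection or SHQP step minimizes the dual function over some blocks,
   and the dual function is strongly convex in their sum; so every half-step
   moves the primal point by at most D, where D^2 is twice the decrease of v
   over the cycle.

   By Farkas' lemma the output of a cycle is sum_a la_a f_a with la >= 0, where
   each active constraint a is tight at a point p_l projected onto in the same
   cycle, hence almost tight (up to S = O(D)) at the final point x = d - sum y_i.
   The lifted value vt = |x|^2/2 + sum_a la_a c_a bounds v(y) from above.  For a
   dual optimal las (one with sum_a las_a f_a = d and sum_a las_a c_a = 0),
     vt = - |x|^2/2 + sum_a (la_a - las_a) (c_a - <f_a,x>) <= S |la - las|_1.
   A Hoffman-type error bound gives an optimal las with |la - las|_1 = O(sqrt vt),
   so vt = O(S^2) = O(decrease of v), which is linear convergence.  Since v is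
   finite after one cycle, this applies from the second cycle on with one
   constant, and kbar = 1 is admissible. *)

(** * Farkas' lemma and bounded coefficients *)

Lemma ler_term_sum (R : numDomainType) (I : finType) (F : I -> R) (i : I) :
  (forall j, 0 <= F j) -> F i <= \sum_j F j.
Proof. by move=> F0; rewrite (bigD1 i)//= lerDl sumr_ge0. Qed.

Section Farkas.
Variables (R : realFieldType) (V : lmodType R).

Lemma scalar_fun0 (g : V -> R) : scalar g -> g 0 = 0.
Proof.
by move=> gL; have := gL (-1) 0 0; rewrite scaler0 addr0 mulN1r addNr.
Qed.

Lemma scalar_funB (g : V -> R) : scalar g ->
  forall a u v, g (u - a *: v) = g u - a * g v.
Proof. by move=> gL a u v; rewrite addrC -scaleNr gL mulNr addrC. Qed.

Lemma scalar_funZ (g : V -> R) : scalar g -> forall a u, g (a *: u) = a * g u.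
Proof. by move=> gL a u; rewrite -[a *: u]addr0 gL scalar_fun0// addr0. Qed.

Lemma scalar_fun_sum (g : V -> R) : scalar g ->
  forall (I : Type) (r : seq I) (P : pred I) (nu : I -> R) (x : I -> V),
  g (\sum_(i <- r | P i) nu i *: x i) = \sum_(i <- r | P i) nu i * g (x i).
Proof.
move=> gL I r P nu x.
rewrite (big_morph g (_ : {morph g : u v / u + v}) (scalar_fun0 gL)).
  by apply: eq_bigr => i _; rewrite scalar_funZ.
by move=> u v; rewrite -[u]scale1r gL mul1r scale1r.
Qed.

(* Bartl's induction: if dropping the constraint [al i] breaks the implication
   at some [x0], scaled to [al i x0 = 1], then the functionals
   [al j - al j x0 * al i] and [ga - ga x0 * al i] satisfy the hypothesis for
   the remaining constraints. *)
Lemma farkas_seq (I : eqType) (r : seq I) (al : I -> V -> R) (ga : V -> R) :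
  uniq r -> (forall i, scalar (al i)) -> scalar ga ->
  (forall x, (forall i, i \in r -> al i x <= 0) -> ga x <= 0) ->
  exists2 u : I -> R, forall i, 0 <= u i &
    forall x, ga x = \sum_(i <- r) u i * al i x.
Proof.
elim: r al ga => [|i r IH] al ga /=.
  move=> _ _ gaL H; exists (fun=> 0) => // x; rewrite big_nil.
  have ga0 z : ga z <= 0 by apply: H.
  apply/eqP; rewrite eq_le ga0//= -oppr_le0.
  by have := ga0 (0 - 1 *: x); rewrite scalar_funB// scalar_fun0// mul1r sub0r.
move=> /andP[ir ur] alL gaL H.
have extend (u : I -> R) (t : R) : (forall j, 0 <= u j) -> 0 <= t ->
    (forall x, ga x = t * al i x + \sum_(j <- r) u j * al j x) ->
    exists2 u : I -> R, forall j, 0 <= u j &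
      forall x, ga x = \sum_(j <- i :: r) u j * al j x.
  move=> u0 t0 gaE; exists (fun j => if j == i then t else u j).
    by move=> j; case: ifP.
  move=> x; rewrite big_cons eqxx gaE; congr (_ + _).
  by apply: eq_big_seq => j jr; case: eqP => // ji; rewrite -ji jr in ir.
have [[x0 [x0r gax0]]|nex] := pselect (exists x0,
    (forall j, j \in r -> al j x0 <= 0) /\ 0 < ga x0); last first.
  have [|u u0 gaE] := IH al ga ur alL gaL.
    by move=> x xr; rewrite leNgt; apply/negP => gax; apply: nex; exists x.
  by apply: (extend u 0) => // x; rewrite mul0r add0r.
have aix0 : 0 < al i x0.
  rewrite ltNge; apply/negP => aix0; move: gax0; apply/negP; rewrite -leNgt.
  by apply: H => j; rewrite inE => /orP[/eqP->//|]; exact: x0r.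
have aix0_neq0 : al i x0 != 0 by rewrite gt_eqF.
pose x1 := (al i x0)^-1 *: x0.
have aix1 : al i x1 = 1 by rewrite scalar_funZ// mulVf.
have x1r j : j \in r -> al j x1 <= 0.
  by move=> jr; rewrite scalar_funZ// pmulr_rle0 ?invr_gt0 ?x0r.
have gax1 : 0 < ga x1 by rewrite scalar_funZ// mulr_gt0 ?invr_gt0.
pose be j x := al j x - al j x1 * al i x.
pose ga' x := ga x - ga x1 * al i x.
have [||x xr|u u0 ga'E] := IH be ga' ur.
- by move=> j a u v; rewrite /be !alL; ring.
- by move=> a u v; rewrite /ga' alL gaL; ring.
(* [ga' x] and [be j x] are the values of [ga] and [al j] at [x - al i x *: x1], where [al i]
   vanishes. *)
- rewrite /ga' mulrC -scalar_funB//; apply: H => j; rewrite inE scalar_funB//.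
  move=> /orP[/eqP->|jr]; first by rewrite aix1 mulr1 subrr.
  by rewrite mulrC xr.
apply: (extend u (ga x1 - \sum_(j <- r) u j * al j x1)) => //.
  rewrite subr_ge0 (le_trans _ (ltW gax1))// big_seq sumr_le0// => j jr.
  by rewrite mulr_ge0_le0// x1r.
move=> x; have -> : ga x = ga' x + ga x1 * al i x by rewrite /ga' subrK.
have -> : ga' x = \sum_(j <- r) u j * al j x
                  - (\sum_(j <- r) u j * al j x1) * al i x.
  rewrite ga'E mulr_suml -sumrB; apply: eq_bigr => j _; rewrite /be; ring.
ring.
Qed.

End Farkas.

(** Homogenization: a scalar [s >= 0] is added and the linear case is applied to [al i x - b i * s]
    and [ga x - be * s]. The multiplier of [s >= 0] is the slack in the final inequality. *)
Lemma farkas_affine (R : realFieldType) (V : lmodType R) (I : finType)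
    (A : pred I) (al : I -> V -> R) (b : I -> R) (ga : V -> R) (be : R) :
  (forall i, scalar (al i)) -> scalar ga ->
  (exists x, forall i, A i -> al i x <= b i) ->
  (forall x, (forall i, A i -> al i x <= b i) -> ga x <= be) ->
  exists u : I -> R, [/\ forall i, 0 <= u i, forall i, ~~ A i -> u i = 0,
    forall x, ga x = \sum_i u i * al i x & \sum_i u i * b i <= be].
Proof.
move=> alL gaL [x0 x0A] H.
pose al' (o : option I) (p : V * R^o) : R :=
  if o is Some i then al i p.1 - b i * p.2 else - p.2.
pose ga' (p : V * R^o) : R := ga p.1 - be * p.2.
pose r : seq (option I) := None :: [seq Some i | i <- enum A].
have ur : uniq r.
  rewrite /= map_inj_uniq ?enum_uniq ?andbT; last exact: Some_inj.
  by apply/mapP => -[].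
have al'L o : scalar (al' o).
  move=> a [u s] [v t]; rewrite /al' /=; case: o => [i|]; last first.
    by rewrite /GRing.scale/=; ring.
  by rewrite alL /GRing.scale/=; ring.
have ga'L : scalar ga'.
  by move=> a [u s] [v t]; rewrite /ga' /= gaL /GRing.scale/=; ring.
have [|u u0 uE] := farkas_seq ur al'L ga'L.
  move=> [x s] xr; rewrite /ga'/=.
  have s0 : 0 <= s by rewrite -oppr_le0; apply: (xr None); rewrite mem_head.
  have {}xr i : A i -> al i x - b i * s <= 0.
    move=> Ai; apply: (xr (Some i)); rewrite inE/=.
    by apply: (map_f Some); rewrite mem_enum.
  move: s0; rewrite le_eqVlt => /orP[/eqP s0|s0].
    (* For [s = 0], [x] is a recession direction: if [ga x > 0], moving from [x0] along it reaches a
       feasible point where [ga] equals [be + 1]. *)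
    rewrite -s0 mulr0 subr0 leNgt; apply/negP => gax.
    have := H (((be - ga x0 + 1) / ga x) *: x + x0); rewrite gaL divfK ?gt_eqF//.
    have -> : be - ga x0 + 1 + ga x0 <= be = false.
      by apply/negbTE; rewrite -ltNge; lra.
    apply/not_implyP; split => // i Ai; rewrite alL.
    have := xr i Ai; rewrite -s0 mulr0 subr0 => alx.
    have bega : 0 <= be - ga x0 by rewrite subr_ge0 H.
    rewrite -[leRHS]add0r lerD ?x0A// mulr_ge0_le0//.
    apply: divr_ge0; last exact: ltW.
    exact: addr_ge0.
  have := H (s^-1 *: x); rewrite scalar_funZ// mulrC ler_pdivrMr//.
  rewrite subr_le0; apply => i Ai.
  by rewrite scalar_funZ// mulrC ler_pdivrMr// -subr_le0 xr.
exists (fun i => if A i then u (Some i) else 0); split.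
- by move=> i; case: ifP.
- by move=> i /negbTE ->.
- move=> x; have := uE (x, 0); rewrite /ga'/= mulr0 subr0 => ->.
  rewrite big_cons /= oppr0 mulr0 add0r big_map big_enum/= [LHS]big_mkcond/=.
  apply: eq_bigr => i _; rewrite unfold_in mulr0 subr0.
  by case: ifP => //; rewrite mul0r.
- have := uE (0, 1); rewrite /ga'/= scalar_fun0// sub0r mulr1 big_cons/=.
  rewrite big_map big_enum/= [X in _ + X]big_mkcond/= mulrN1.
  have -> : \sum_i (if i \in A then u (Some i) * (al i 0 - b i * 1) else 0) =
      - \sum_i (if A i then u (Some i) else 0) * b i.
    rewrite -sumrN; apply: eq_bigr => i _; rewrite unfold_in.
    by case: ifP => _; rewrite ?mul0r ?oppr0// scalar_fun0// sub0r mulr1 mulrN.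
  move=> E; have := u0 None; lra.
Qed.

(* The Gram matrix of [g] determines [\sum_i nu i *: g i], and its
   pseudo-inverse recovers a bounded choice of coefficients. *)
Lemma gram_bound (R : realType) (Y : normedModType R) (B : Y -> Y -> R) (C : R)
    (I : finType) (g : I -> Y) :
  0 <= C -> (forall y, scalar (B^~ y)) -> (forall y, scalar (B y)) ->
  (forall y, B y y = 0 -> y = 0) ->
  (forall y z, `|B y z| <= C * `|y| * `|z|) ->
  exists kappa : R, forall nu : I -> R, exists2 nu' : I -> R,
    \sum_i nu' i *: g i = \sum_i nu i *: g i &
    forall i, `|nu' i| <= kappa * `|\sum_j nu j *: g j|.
Proof.
move=> C0 Bl Br Bdef Bbd.
pose M : 'M[R]_#|I| := \matrix_(i, j) B (g (enum_val i)) (g (enum_val j)).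
pose row_of (nu : I -> R) : 'rV[R]_#|I| := \row_i nu (enum_val i).
have row_ofM nu j : (row_of nu *m M) 0 j = B (\sum_i nu i *: g i) (g (enum_val j)).
  rewrite (scalar_fun_sum (Bl _)) mxE [RHS](reindex (@enum_val I I))/=;
    last exact: onW_bij (enum_val_bij I).
  apply: eq_bigr => i _.
  by rewrite !mxE.
exists (\sum_i \sum_j (C * `|g (enum_val j)|) * `|pinvmx M j i|) => nu.
pose N := row_of nu *m M *m pinvmx M.
exists (fun i => N 0 (enum_rank i)); last first.
  move=> i; pose F k := \sum_j (C * `|g (enum_val j)|) * `|pinvmx M j k|.
  have F0 k : 0 <= F k by apply: sumr_ge0 => j _; rewrite !mulr_ge0.
  apply: le_trans (ler_wpM2r _ (ler_term_sum (enum_rank i) F0)) => //.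
  rewrite mxE (le_trans (ler_norm_sum _ _ _))// mulr_suml.
  apply: ler_sum => j _; rewrite normrM row_ofM.
  rewrite mulrAC ler_wpM2r// (le_trans (Bbd _ _))// -!mulrA.
  by rewrite ler_wpM2l// mulrC.
have NE : row_of (fun i => N 0 (enum_rank i)) = N.
  by apply/rowP => j; rewrite mxE enum_valK.
set x := LHS; set y := RHS; apply/eqP; rewrite -subr_eq0; apply/eqP/Bdef.
(* Both combinations have the same products with every [g i]; their difference lies in the span,
   hence is orthogonal to itself. *)
have Bxy i : B (x - y) (g i) = 0.
  rewrite -[y]scale1r (scalar_funB (Bl _)) mul1r -[i]enum_rankK -!row_ofM NE.
  by rewrite mulmxKpV ?submxMl// subrr.
have E : x - y = \sum_i (N 0 (enum_rank i) - nu i) *: g i.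
  by rewrite /x /y -sumrB; apply: eq_bigr => i _; rewrite scalerBl.
by rewrite [X in B _ X]E (scalar_fun_sum (Br _)) big1// => i _; rewrite Bxy mulr0.
Qed.

(** * Error bound for finitely generated cones *)

Definition independent (R : pzRingType) (Y : lmodType R) (I : finType)
    (g : I -> Y) (A : {set I}) :=
  forall nu : I -> R, (forall i, i \notin A -> nu i = 0) ->
    \sum_i nu i *: g i = 0 -> forall i, nu i = 0.

(** While the support is dependent, moving along a dependency until a coefficient vanishes keeps the
    sum and shrinks the support. *)
Lemma caratheodory_cone (R : realFieldType) (Y : lmodType R) (I : finType)
    (g : I -> Y) (la : I -> R) :
  (forall i, 0 <= la i) ->
  exists la' : I -> R, [/\ forall i, 0 <= la' i, forall i, la i = 0 -> la' i = 0,
    \sum_i la' i *: g i = \sum_i la i *: g i &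
    independent g [set i | la' i != 0%R]%SET].
Proof.
have [n] := ubnP #|[set i | la i != 0%R]%SET|; elim: n => // n IH in la *.
rewrite ltnS => len la0.
have [ind|] := pselect (independent g [set i | la i != 0%R]%SET); first by exists la.
move=> /existsNP[nu /not_implyP[nuA /not_implyP[nug /existsNP[i0 /eqP nui0]]]].
wlog nui0_gt0 : nu nuA nug nui0 / 0 < nu i0.
  move=> W; have [|nui0_le0] := ltP 0 (nu i0); first exact: W.
  apply: (W (fun i => - nu i)) => [i /nuA->||| ]; rewrite ?oppr0 ?oppr_eq0//.
    by under eq_bigr do rewrite scaleNr; rewrite sumrN nug oppr0.
  by rewrite oppr_gt0 lt_neqAle nui0.
(* The minimal ratio is the largest step along [- nu] that keeps all coefficients nonnegative. *)
pose i1 := [arg min_(i < i0 | 0 < nu i) (la i / nu i)]%O.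
have [nui1 mini1] : 0 < nu i1 /\ forall j, 0 < nu j -> la i1 / nu i1 <= la j / nu j.
  by rewrite /i1; case: arg_minP.
pose t := la i1 / nu i1.
have t0 : 0 <= t by rewrite divr_ge0// ltW.
pose mu i := la i - t * nu i.
have lamu i : la i = 0 -> mu i = 0.
  by move=> lai; rewrite /mu lai nuA ?inE ?lai ?eqxx// mulr0 subr0.
have mu0 i : 0 <= mu i.
  rewrite subr_ge0; have [nui|nui] := ltP 0 (nu i).
    by rewrite -ler_pdivlMr// mini1.
  by rewrite (le_trans _ (la0 i))// mulr_ge0_le0.
have mug : \sum_i mu i *: g i = \sum_i la i *: g i.
  under eq_bigr do rewrite scalerBl -scalerA.
  by rewrite sumrB -scaler_sumr nug scaler0 subr0.
have lt_mu : (#|[set i | mu i != 0%R]%SET| < n)%N.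
  apply: leq_trans len; apply: proper_card; apply/properP; split.
    by apply/fintype.subsetP => i; rewrite !inE; apply: contra => /eqP/lamu ->.
  exists i1; rewrite !inE; last by rewrite /mu /t divfK ?(gt_eqF nui1)// subrr eqxx.
  apply: contraTneq nui1 => lai1; rewrite nuA ?ltxx// inE lai1 eqxx//.
have [la' [la'0 la'mu la'g ind]] := IH mu lt_mu mu0.
exists la'; split => // [i /lamu/la'mu//|]; by rewrite la'g.
Qed.

(** Isolated as a property of a normed space because it is needed on a product with the max norm,
    which is not an inner product norm. *)
Definition bounded_coefficients (R : realType) (Y : normedModType R) :=
  forall (I : finType) (g : I -> Y), exists kappa : R,
  forall nu : I -> R, exists2 nu' : I -> R,
    \sum_i nu' i *: g i = \sum_i nu i *: g i &
    forall i, `|nu' i| <= kappa * `|\sum_j nu j *: g j|.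

Section ErrorBound.
Variables (R : realType) (Y : normedModType R).
Hypothesis Ybd : bounded_coefficients Y.
Variables (I : finType) (g : I -> Y).

Lemma masked_sum (A : {set I}) (nu : I -> R) :
  \sum_i nu i *: (if i \in A then g i else 0) =
  \sum_i (if i \in A then nu i else 0) *: g i.
Proof. by apply: eq_bigr => i _; case: ifP; rewrite ?scaler0 ?scale0r. Qed.

Lemma masked_supp (A : {set I}) (nu : I -> R) :
  (forall i, i \notin A -> nu i = 0) ->
  \sum_i nu i *: (if i \in A then g i else 0) = \sum_i nu i *: g i.
Proof.
move=> nuA; rewrite masked_sum; apply: eq_bigr => i _.
by have [//|/nuA->] := boolP (i \in A).
Qed.

(** Independence makes coefficients unique, so the bounded choice given by [Ybd] agrees with [nu] on
    [A]. *)
Lemma independent_bound (A : {set I}) : independent g A ->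
  exists2 kappa : R, 0 < kappa & forall nu : I -> R,
    (forall i, i \notin A -> nu i = 0) ->
    forall i, `|nu i| <= kappa * `|\sum_j nu j *: g j|.
Proof.
move=> ind; have [k kP] := Ybd (fun i => if i \in A then g i else 0).
exists (`|k| + 1) => [|nu nuA i]; first by rewrite ltr_wpDl.
have [nu' nu'g nu'k] := kP nu.
have -> : nu i = if i \in A then nu' i else 0.
  apply/eqP; rewrite -subr_eq0; apply/eqP; move: i.
  apply: (ind (fun i => nu i - if i \in A then nu' i else 0)) => [j jA|].
    by rewrite (negbTE jA) nuA// subrr.
  under eq_bigr do rewrite scalerBl.
  by rewrite sumrB -masked_sum nu'g masked_supp// subrr.
have k1 : `|nu' i| <= (`|k| + 1) * `|\sum_j nu j *: g j|.
  rewrite -(masked_supp nuA) (le_trans (nu'k i))// ler_wpM2r//.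
  by rewrite (le_trans (ler_norm k))// lerDl.
by case: ifP => // _; rewrite normr0 (le_trans _ k1).
Qed.

(** [h] is adjoined to the family with coefficient -1. If the bounded recombination keeps this
    coefficient, its bound gives the distance; otherwise subtracting the two combinations puts [h]
    in the span. *)
Lemma span_dist (A : {set I}) (h : Y) :
  (forall nu : I -> R, (forall i, i \notin A -> nu i = 0) ->
     \sum_i nu i *: g i != h) ->
  exists2 eps : R, 0 < eps & forall nu : I -> R,
    (forall i, i \notin A -> nu i = 0) -> eps <= `|\sum_i nu i *: g i - h|.
Proof.
move=> hA; pose gA i := if i \in A then g i else 0.
have [k kP] := Ybd (fun o : I + 'I_1 => if o is inl i then gA i else h).
exists (`|k| + 1)^-1 => [|nu nuA]; first by rewrite invr_gt0 ltr_wpDl.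
have [nu' ] := kP (fun o : I + 'I_1 => if o is inl i then nu i else -1).
rewrite !big_sumType/= !big_ord1 scaleN1r (masked_supp nuA) => nu'g.
have [nu'N|nu'N] := eqVneq (nu' (inr 0)) (-1).
  move=> /(_ (inr 0)); rewrite nu'N normrN1 => k1.
  rewrite -[leLHS]mulr1 ler_pdivrMl ?ltr_wpDl//.
  apply: le_trans k1 _; rewrite ler_wpM2r//.
  by rewrite (le_trans (ler_norm k))// lerDl.
exfalso; pose a := nu' (inr 0) + 1.
have a0 : a != 0 by rewrite addr_eq0.
pose mu i := a^-1 * (nu i - if i \in A then nu' (inl i) else 0).
have muA i : i \notin A -> mu i = 0.
  by move=> iA; rewrite /mu (negbTE iA) nuA// subrr mulr0.
have /eqP := hA mu muA; apply.
under eq_bigr do rewrite -scalerA scalerBl.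
rewrite -scaler_sumr sumrB -(masked_sum A (fun i => nu' (inl i))).
have -> : \sum_i nu i *: g i = \sum_i nu' (inl i) *: gA i + nu' (inr 0) *: h + h.
  by rewrite nu'g subrK.
rewrite -[X in X - _]addrA [X in X - _]addrC addrK -{2}[h]scale1r -scalerDl scalerA.
by rewrite mulVf// scale1r.
Qed.

(** Three cases: [h] is outside the span of [A]; its unique coefficients [nu] are nonnegative, and
    [las = nu] works; or some [nu i] is negative, and [la i >= 0] keeps the sum at distance at least
    [- nu i / k] from [h]. In the first and last cases [las = la0], with [M] bounding [la]. *)
Lemma error_bound_supp (A : {set I}) (h : Y) (la0 : I -> R) (M : R) :
  independent g A -> (forall i, 0 <= la0 i) -> \sum_i la0 i *: g i = h ->
  exists2 kappa : R, 0 <= kappa & forall la : I -> R,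
    (forall i, 0 <= la i) -> (forall i, i \notin A -> la i = 0) ->
    `|\sum_i la i *: g i| <= M ->
    exists las : I -> R, [/\ forall i, 0 <= las i,
      forall i, i \notin A -> la0 i = 0 -> las i = 0, \sum_i las i *: g i = h &
      \sum_i `|la i - las i| <= kappa * `|\sum_i la i *: g i - h|].
Proof.
move=> ind la00 la0h; have [k k0 kP] := independent_bound ind.
(* outside an [eps]-ball around [h], the fixed representation [la0] will do *)
have far (eps : R) : 0 < eps ->
    (forall la : I -> R, (forall i, 0 <= la i) -> (forall i, i \notin A -> la i = 0) ->
      eps <= `|\sum_i la i *: g i - h|) ->
    exists2 kappa : R, 0 <= kappa & forall la : I -> R,
    (forall i, 0 <= la i) -> (forall i, i \notin A -> la i = 0) ->
    `|\sum_i la i *: g i| <= M ->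
    exists las : I -> R, [/\ forall i, 0 <= las i,
      forall i, i \notin A -> la0 i = 0 -> las i = 0, \sum_i las i *: g i = h &
      \sum_i `|la i - las i| <= kappa * `|\sum_i la i *: g i - h|].
  move=> eps0 epsP; pose S := \sum_(i : I) (k * `|M| + la0 i).
  have S0 : 0 <= S.
    by apply: sumr_ge0 => i _; rewrite addr_ge0// mulr_ge0// ltW.
  exists (S / eps) => [|la la_ge0 laA laM]; first by rewrite divr_ge0// ltW.
  exists la0; split => //; apply: (@le_trans _ _ S).
    apply: ler_sum => i _; rewrite (le_trans (ler_normB _ _))// lerD//.
      rewrite (le_trans (kP la laA i))// ler_wpM2l ?(ltW k0)//.
      by rewrite (le_trans laM)// ler_norm.
    by rewrite ger0_norm.
  by rewrite mulrAC ler_pdivlMr// ler_wpM2l// epsP.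
have [[nu [nuA nuh]]|nex] := pselect (exists nu : I -> R,
    (forall i, i \notin A -> nu i = 0) /\ \sum_i nu i *: g i = h); last first.
  have [|eps eps0 epsP] := @span_dist A h.
    by move=> nu nuA; apply/eqP => nuh; apply: nex; exists nu.
  by apply: (far eps) => // la _; exact: epsP.
have dist la : (forall i, i \notin A -> la i = 0) ->
    forall i, `|la i - nu i| <= k * `|\sum_i la i *: g i - h|.
  move=> laA i.
  have -> : \sum_i la i *: g i - h = \sum_i (la i - nu i) *: g i.
    by under [RHS]eq_bigr do rewrite scalerBl; rewrite sumrB nuh.
  by apply: (kP (fun i => la i - nu i)) => j jA; rewrite laA// nuA// subrr.
have [nu0|/existsNP[i /negP]] := pselect (forall i, 0 <= nu i).
  exists (\sum_(i : I) k) => [|la la_ge0 laA laM].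
    by apply: sumr_ge0 => i _; exact: ltW.
  exists nu; split => // [i iA _|]; first exact: nuA.
  by rewrite mulr_suml; apply: ler_sum => i _; exact: dist.
rewrite -ltNge => nui; apply: (far (- nu i / k)).
  by rewrite divr_gt0// oppr_gt0.
move=> la la_ge0 laA; rewrite ler_pdivrMr// mulrC (le_trans _ (dist la laA i))//.
by rewrite (le_trans _ (ler_norm _))// lerDr.
Qed.

(** Carathéodory's reduction replaces [la] by some [la'] with independent support. There are
    finitely many supports, so the sum of their constants serves them all. *)
Lemma error_bound (h : Y) (la0 : I -> R) (M : R) :
  (forall i, 0 <= la0 i) -> \sum_i la0 i *: g i = h ->
  exists2 kappa : R, 0 <= kappa & forall la : I -> R,
    (forall i, 0 <= la i) -> `|\sum_i la i *: g i| <= M ->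
    exists la' las : I -> R,
      [/\ forall i, 0 <= la' i, forall i, la i = 0 -> la' i = 0 &
        \sum_i la' i *: g i = \sum_i la i *: g i] /\
      [/\ forall i, 0 <= las i,
        forall i, la i = 0 -> la0 i = 0 -> las i = 0, \sum_i las i *: g i = h &
        \sum_i `|la' i - las i| <= kappa * `|\sum_i la i *: g i - h|].
Proof.
move=> la00 la0h.
have H (A : {set I}) : exists k : R, 0 <= k /\ (independent g A ->
    forall la : I -> R,
    (forall i, 0 <= la i) -> (forall i, i \notin A -> la i = 0) ->
    `|\sum_i la i *: g i| <= M ->
    exists las : I -> R, [/\ forall i, 0 <= las i,
      forall i, i \notin A -> la0 i = 0 -> las i = 0, \sum_i las i *: g i = h &
      \sum_i `|la i - las i| <= k * `|\sum_i la i *: g i - h|]).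
  have [ind|ind] := pselect (independent g A); last by exists 0; split.
  by have [k k0 kP] := error_bound_supp M ind la00 la0h; exists k; split.
have [k kP] := choice H; have k0 A : 0 <= k A by have [] := kP A.
exists (\sum_A k A) => [|la la_ge0 laM]; first exact: sumr_ge0.
have [la' [la'0 la'la la'g ind]] := caratheodory_cone g la_ge0.
have [_ /(_ ind la' la'0)[||las [las0 lasA lash lask]]] := kP [set i | la' i != 0%R]%SET.
- by move=> i; rewrite inE negbK => /eqP.
- by rewrite la'g.
exists la', las; do 2 split => //.
  by move=> i lai; apply: lasA; rewrite inE la'la// eqxx.
rewrite (le_trans lask)// la'g ler_wpM2r//.
exact: (ler_term_sum (F := k)).
Qed.

End ErrorBound.

(** * Geometry of the inner product *)

(** Stands in for the limit [t -> 0] in first-order conditions. If [g > 0] then [b > 0], and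
    [t = min(1, g / (2 b))] yields [g <= g / 2]. *)
Lemma le0_vanishing (R : realFieldType) (g b : R) :
  (forall t, 0 < t -> t <= 1 -> g <= t * b) -> g <= 0.
Proof.
move=> H; have [g_gt0|//] := ltP 0 g.
have b0 : 0 < b by rewrite -[b]mul1r (lt_le_trans g_gt0)// H.
have := H (Num.min 1 (g / b / 2)); rewrite ge_min lexx lt_min ltr01 !divr_gt0//=.
move=> /(_ isT isT) => /le_trans/(_ (ler_wpM2r (ltW b0) _)) => /(_ (g / b / 2)).
by rewrite ge_min lexx orbT mulrAC divfK ?gt_eqF// => /(_ isT); lra.
Qed.

Section InnerProduct.
Variables (R : realType) (X : completeNormedModType R) (ip : {dot X for idfun}).
Hypothesis norm_ip : forall x : X, `|x| ^+ 2 = ip x x.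

Lemma ipC u v : ip u v = ip v u.
Proof. by rewrite hermC expr0 mul1r. Qed.

Lemma ip_scalarl z : scalar (ip^~ z).
Proof. by move=> a u v; rewrite linearPl. Qed.

Lemma ip_scalarr z : scalar (ip z).
Proof. by move=> a u v; rewrite linearPr. Qed.

Lemma ipZl a u v : ip (a *: u) v = a * ip u v.
Proof. by rewrite linearZl_LR. Qed.

Lemma ipZr a u v : ip u (a *: v) = a * ip u v.
Proof. by rewrite ipC ipZl ipC. Qed.

Lemma ipDl u v z : ip (u + v) z = ip u z + ip v z. Proof. exact: linearDl. Qed.
Lemma ipDr z u v : ip z (u + v) = ip z u + ip z v. Proof. exact: linearDr. Qed.
Lemma ipBl u v z : ip (u - v) z = ip u z - ip v z. Proof. exact: linearBl. Qed.
Lemma ipBr z u v : ip z (u - v) = ip z u - ip z v. Proof. exact: linearBr. Qed.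
Lemma ipNl u z : ip (- u) z = - ip u z. Proof. exact: linearNl. Qed.
Lemma ipNr z u : ip z (- u) = - ip z u. Proof. exact: linearNr. Qed.
Lemma ip0l z : ip 0 z = 0. Proof. exact: linear0l. Qed.
Lemma ip0r z : ip z 0 = 0. Proof. exact: linear0r. Qed.

Definition ipE := (ipDl, ipDr, ipBl, ipBr, ipNl, ipNr, ipZl, ipZr).

Lemma normD_sqr u v : `|u + v| ^+ 2 = `|u| ^+ 2 + 2 * ip u v + `|v| ^+ 2.
Proof. by rewrite !norm_ip !ipE (ipC v u); ring. Qed.

Lemma normB_sqr u v : `|u - v| ^+ 2 = `|u| ^+ 2 - 2 * ip u v + `|v| ^+ 2.
Proof. by rewrite normD_sqr normrN !ipE mulrN. Qed.

Lemma ip_le u v : ip u v <= `|u| * `|v|.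
Proof.
have : `|u + v| ^+ 2 <= (`|u| + `|v|) ^+ 2.
  by rewrite ler_pXn2r ?nnegrE ?addr_ge0// ler_normD.
rewrite normD_sqr; lra.
Qed.

Lemma ip_normr u v : `|ip u v| <= `|u| * `|v|.
Proof.
by rewrite ler_norml ip_le andbT lerNl -ipNl -[`|u|]normrN ip_le.
Qed.

Lemma ip_inj u v : (forall x, ip x u = ip x v) -> u = v.
Proof.
move=> uv; apply/eqP; rewrite -subr_eq0 -normr_eq0 -sqrf_eq0 norm_ip ipBr.
by rewrite uv subrr.
Qed.

Lemma projection_variational (D : set X) (z p : X) :
  (forall q t, D q -> 0 <= t <= 1 -> D (p + t *: (q - p))) ->
  is_projection D z p -> forall q, D q -> ip (z - p) (q - p) <= 0.
Proof.
move=> Dconv [Dp pmin] q Dq; apply: (@le0_vanishing _ _ (2^-1 * `|q - p| ^+ 2)).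
move=> t t0 t1; have := pmin _ (Dconv q t Dq _); rewrite t1 ltW// => /(_ isT).
rewrite opprD addrA -ler_sqr ?nnegrE// (normB_sqr (z - p)) ipZr normrZ exprMn.
by rewrite (ger0_norm (ltW t0)) => H; rewrite -(ler_pM2l t0); lra.
Qed.

Lemma farkas_ip (J : finType) (A : pred J) (F : J -> X) (b : J -> R) (e : X) (be : R) :
  (exists x, forall l, A l -> ip x (F l) <= b l) ->
  (forall x, (forall l, A l -> ip x (F l) <= b l) -> ip x e <= be) ->
  exists t : J -> R, [/\ forall l, 0 <= t l, forall l, ~~ A l -> t l = 0,
    e = \sum_l t l *: F l & \sum_l t l * b l <= be].
Proof.
move=> ne H.
have [t [t0 tA tE tb]] := farkas_affine (fun l => ip_scalarl (F l)) (ip_scalarl e) ne H.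
exists t; split => //; apply: ip_inj => x.
by rewrite tE (scalar_fun_sum (ip_scalarr x)).
Qed.

(** Infinite bounds are discarded before Farkas' lemma is applied with right-hand side [ip p e]. The
    slack terms are nonnegative with sum at most 0, which gives complementary slackness. *)
Lemma normal_cone_polyhedron (J : finType) (A : pred J) (F : J -> X)
    (c : J -> \bar R) (p e : X) :
  (forall l, A l -> ((ip p (F l))%:E <= c l)%E) ->
  (forall q, (forall l, A l -> ((ip q (F l))%:E <= c l)%E) -> ip q e <= ip p e) ->
  exists t : J -> R, [/\ forall l, 0 <= t l, e = \sum_l t l *: F l &
    forall l, t l != 0 -> A l /\ c l = (ip p (F l))%:E].
Proof.
move=> pA H; pose A' l := A l && (c l \is a fin_num).
have A'c x : (forall l, A' l -> ip x (F l) <= fine (c l)) <->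
    (forall l, A l -> ((ip x (F l))%:E <= c l)%E).
  split=> xA l; last first.
    by move=> /andP[/xA xl cl]; rewrite -lee_fin fineK.
  move=> Al; have := xA l; rewrite /A' Al/=; have := pA l Al.
  by case: (c l) => [r||]//=; rewrite ?leey// lee_fin => _; apply.
have [|x /A'c xA|t [t0 tA tE tb]] := @farkas_ip J A' F (fine \o c) e (ip p e).
- by exists p; apply/A'c.
- exact: H.
have tA' l : t l != 0 -> A' l by apply: contraR => /tA ->.
exists t; split => // l tl; have /andP[Al cl] := tA' l tl; split => //.
have slack k : 0 <= t k * (fine (c k) - ip p (F k)).
  have [->|/tA' A'k] := eqVneq (t k) 0; first by rewrite mul0r.
  by rewrite mulr_ge0// subr_ge0; apply/A'c: k A'k.
have : \sum_k t k * (fine (c k) - ip p (F k)) <= 0.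
  under eq_bigr do rewrite mulrBr.
  by rewrite sumrB subr_le0 -(scalar_fun_sum (ip_scalarr p)) -tE.
move=> /(le_trans (ler_term_sum l slack)).
rewrite pmulr_rle0 ?lt_neqAle 1?eq_sym ?tl//= subr_le0 => cp.
rewrite -(fineK cl); congr (_%:E); apply/eqP; rewrite eq_le cp/=.
by rewrite -lee_fin fineK// pA.
Qed.

Lemma support_fun_ge (u : X) (D : set X) x : D x -> ((ip u x)%:E <= support_fun ip u D)%E.
Proof. by move=> Dx; apply: ereal_sup_ubound; exists x. Qed.

Lemma support_fun_le (u : X) (D : set X) (be : R) :
  (forall x, D x -> ip u x <= be) -> (support_fun ip u D <= be%:E)%E.
Proof. by move=> H; apply/ereal_supP => _ [x Dx <-]; rewrite lee_fin H. Qed.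

Lemma support_fun_mono (u : X) (D E : set X) :
  D `<=` E -> (support_fun ip u D <= support_fun ip u E)%E.
Proof. by move=> DE; apply: ereal_sup_le => _ [x Dx <-]; exists x => //; exact: DE. Qed.

Lemma support_fun_ge0 (u : X) (D : set X) : D 0 -> (0 <= support_fun ip u D)%E.
Proof. by move=> D0; rewrite -[0%E]/(0%:E) -(ip0r u); exact: support_fun_ge. Qed.

Lemma support_fun0 (D : set X) : D !=set0 -> support_fun ip 0 D = 0%E.
Proof.
move=> [x Dx]; apply/eqP; rewrite eq_le support_fun_le/=; last first.
  by move=> y _; rewrite ip0l.
by rewrite -[X in (X%:E <= _)%E](ip0l x) support_fun_ge.
Qed.

Lemma support_fun_segment (u w : X) (D : set X) (t a b : R) : 0 <= t <= 1 ->
  support_fun ip u D = a%:E -> support_fun ip w D = b%:E ->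
  (support_fun ip (u + t *: (w - u))%R D <= (a + t * (b - a))%:E)%E.
Proof.
move=> /andP[t0 t1] ua wb; apply: support_fun_le => x Dx.
have := support_fun_ge u Dx; have := support_fun_ge w Dx.
rewrite ua wb !lee_fin => xb xa; rewrite !ipE.
have -> : a + t * (b - a) = (1 - t) * a + t * b by ring.
have -> : ip u x + t * (ip w x - ip u x) = (1 - t) * ip u x + t * ip w x by ring.
by rewrite lerD// ler_wpM2l// subr_ge0.
Qed.

End InnerProduct.

(** * Strong convexity of the dual objective *)

Section DualDecrease.
Variables (R : realType) (X : completeNormedModType R) (ip : {dot X for idfun}).
Hypothesis norm_ip : forall x : X, `|x| ^+ 2 = ip x x.
Variables (I : finType).

Definition block_obj (A : pred I) (P : I -> set X) (q : X) (u : I -> X) : \bar R :=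
  ((2^-1 * `|q - \sum_(i | A i) u i| ^+ 2)%:E
   + \sum_(i | A i) support_fun ip (u i) (P i))%E.

Lemma support_le_block_obj (A : pred I) (P : I -> set X) (q : X) (u : I -> X) i :
  (forall i, A i -> P i 0) -> A i ->
  (support_fun ip (u i) (P i) <= block_obj A P q u)%E.
Proof.
move=> P0 Ai; have s0 k : A k -> (0 <= support_fun ip (u k) (P k))%E.
  by move=> Ak; apply: support_fun_ge0; exact: P0.
rewrite /block_obj [X in (_ + X)%E](bigD1 i)//= addeCA leeDl//.
rewrite adde_ge0 ?lee_fin ?mulr_ge0//.
by apply: sume_ge0 => k /andP[Ak _]; exact: s0.
Qed.

Lemma block_obj_fin (A : pred I) (P : I -> set X) (q : X) (u : I -> X) :
  (forall i, A i -> P i 0) -> (block_obj A P q u < +oo)%E ->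
  forall i, A i -> support_fun ip (u i) (P i) \is a fin_num.
Proof.
move=> P0 u_fin i Ai; rewrite ge0_fin_numE; last exact/support_fun_ge0/P0.
exact: le_lt_trans (support_le_block_obj q u P0 Ai) u_fin.
Qed.

Lemma block_obj0_lty (A : pred I) (P : I -> set X) (q : X) :
  (forall i, A i -> P i 0) -> (block_obj A P q (fun=> 0%R) < +oo)%E.
Proof.
move=> P0; rewrite /block_obj [X in (_ + X)%E]big1 ?adde0 ?ltry// => i Ai.
by apply: support_fun0; exists 0; exact: P0.
Qed.

(** Minimality along the segment from [u0] to [u] gives a first-order condition; the exact expansion
    of the square then leaves the quadratic term. Only the block sum is controlled, not the single
    blocks. *)
Lemma block_obj_growth (A : pred I) (P : I -> set X) (q : X) (u0 u : I -> X) :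
  (forall i, A i -> P i 0) ->
  (forall w, (block_obj A P q u0 <= block_obj A P q w)%E) ->
  (block_obj A P q u0 +
     (2^-1 * `|\sum_(i | A i) u i - \sum_(i | A i) u0 i| ^+ 2)%:E
   <= block_obj A P q u)%E.
Proof.
move=> P0 u0min; have [->|] := eqVneq (block_obj A P q u) +oo%E; first exact: leey.
rewrite -ltey => u_fin; have u0_fin := le_lt_trans (u0min u) u_fin.
pose a i := fine (support_fun ip (u0 i) (P i)).
pose b i := fine (support_fun ip (u i) (P i)).
have aE i : A i -> support_fun ip (u0 i) (P i) = (a i)%:E.
  by move=> Ai; rewrite /a fineK// (block_obj_fin P0 u0_fin).
have bE i : A i -> support_fun ip (u i) (P i) = (b i)%:E.
  by move=> Ai; rewrite /b fineK// (block_obj_fin P0 u_fin).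
set D := \sum_(i | A i) u i - _; pose x := q - \sum_(i | A i) u0 i.
have ab : ip x D - (\sum_(i | A i) b i - \sum_(i | A i) a i) <= 0.
  apply: (@le0_vanishing _ _ (2^-1 * `|D| ^+ 2)) => t t0 t1.
  pose w i := u0 i + t *: (u i - u0 i).
  have w_le : (block_obj A P q w <= (2^-1 * `|x - t *: D| ^+ 2 +
      \sum_(i | A i) (a i + t * (b i - a i)))%:E)%E.
    rewrite EFinD -sumEFin; apply: leeD.
      rewrite lee_fin /w big_split/= -scaler_sumr sumrB opprD addrA.
      exact: lexx.
    apply: lee_sum => i Ai; apply: support_fun_segment; rewrite ?aE ?bE//.
    by rewrite ltW.
  have := le_trans (u0min w) w_le.
  rewrite {1}/block_obj (eq_bigr _ aE) sumEFin -EFinD -/x lee_fin.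
  rewrite big_split/= -mulr_sumr sumrB.
  rewrite (normB_sqr norm_ip x) (ipZr ip) normrZ (ger0_norm (ltW t0)) exprMn => H.
  rewrite -(ler_pM2l t0); lra.
rewrite {1}/block_obj /block_obj (eq_bigr _ aE) (eq_bigr _ bE) !sumEFin -!EFinD.
have -> : q - \sum_(i | A i) u i = x - D by rewrite /x /D opprB addrA subrK.
rewrite -/x lee_fin (normB_sqr norm_ip x); lra.
Qed.

End DualDecrease.

(** * Last visit to a block *)

Section LastPos.
Variables (m : nat) (s : int -> 'I_m).

Lemma last_pos_le (j : nat) (i : 'I_m) (p : int) :
  (forall t, (t < m + j)%N -> s (1 - m%:Z + t%:Z) = i -> 1 - m%:Z + t%:Z <= p) ->
  1 - m%:Z <= p -> last_pos s j i <= p.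
Proof.
move=> H mp; rewrite /last_pos big_seq_cond; apply: bigmax_le => // t.
by rewrite mem_index_iota => /andP[/andP[_ tmj] /eqP]; exact: H.
Qed.

Lemma last_pos_ge (j : nat) (i : 'I_m) (t : nat) :
  (t < m + j)%N -> s (1 - m%:Z + t%:Z) = i -> 1 - m%:Z + t%:Z <= last_pos s j i.
Proof.
move=> tmj si; apply: (@le_bigmax_seq _ _ _ _ _ t); last by apply/eqP.
by rewrite mem_index_iota.
Qed.

Lemma last_pos0 (i : 'I_m) : (forall i : 'I_m, s (i.+1%:Z - m%:Z) = i) ->
  last_pos s 0 i = i.+1%:Z - m%:Z.
Proof.
(* The positions [1 - m + t] with [t < m] form the initial stretch, where each block occurs exactly
   once. *)
move=> s0; have sE t (tm : (t < m)%N) : s (1 - m%:Z + t%:Z) = Ordinal tm.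
  by rewrite -[RHS]s0/=; congr s; lia.
apply/eqP; rewrite eq_le; apply/andP; split; last first.
  have := @last_pos_ge 0 i i; rewrite addn0 ltn_ord sE => /(_ isT).
  have -> : Ordinal (ltn_ord i) = i by exact: val_inj.
  by move=> /(_ erefl); lia.
apply: last_pos_le => [t|]; last by lia.
by rewrite addn0 => tm; rewrite sE => <-/=; lia.
Qed.

Lemma last_posS (j : nat) (i : 'I_m) :
  last_pos s j.+1 i = if s j.+1%:Z == i then j.+1%:Z else last_pos s j i.
Proof.
have m0 : (0 < m)%N by exact: leq_ltn_trans (ltn_ord i).
have jE : j.+1%:Z = 1 - m%:Z + (m + j)%N%:Z by lia.
have mge k : 1 - m%:Z <= last_pos s k i.
  by rewrite /last_pos; elim/big_rec: _ => // t x _ mx; rewrite le_max mx orbT.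
apply/eqP; rewrite eq_le; case: eqP => [si|sNi]; apply/andP; split.
- by apply: last_pos_le => [t|]; lia.
- by rewrite [leLHS]jE last_pos_ge ?addnS// -jE.
- apply: last_pos_le => // t; rewrite addnS ltnS leq_eqVlt => /orP[/eqP ->|].
    by rewrite -jE => /sNi.
  exact: last_pos_ge.
- by apply: last_pos_le => [t tmj|]; [apply: last_pos_ge; rewrite addnS ltnW|].
Qed.

End LastPos.

(** * One cycle *)

Section Cycle.
Variables (R : realType) (X : completeNormedModType R) (ip : {dot X for idfun}).
Hypothesis norm_ip : forall x : X, `|x| ^+ 2 = ip x x.
Variables (m : nat) (C : 'I_m -> set X) (d : X).
Hypothesis C0 : forall i, C i 0.
Hypothesis Cconv : forall i p q t, C i p -> C i q -> 0 <= t <= 1 ->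
  C i (p + t *: (q - p)).

Lemma dual_fun_ge0 (u : 'I_m -> X) : (0 <= dual_fun ip C d u)%E.
Proof.
rewrite adde_ge0 ?lee_fin ?mulr_ge0//; apply: sume_ge0 => i _.
exact: support_fun_ge0.
Qed.

Lemma dual_fun_split (Q : {set 'I_m}) (u : 'I_m -> X) :
  dual_fun ip C d u =
  (block_obj ip (mem Q) C (d - \sum_(i | i \notin Q) u i)%R u +
   \sum_(i | i \notin Q) support_fun ip (u i) (C i))%E.
Proof.
rewrite /dual_fun /block_obj -addeA; congr (_ + _)%E.
  by rewrite (bigID (mem Q))/= opprD addrCA addrC -addrA [- _ - _]addrC.
by rewrite (bigID (mem Q)).
Qed.

Variables (cy : shqp_cycle X m) (yin yout : 'I_m -> X).
Hypothesis spec : cycle_spec ip C d cy yin yout.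
Let s := cyc_s cy.
Let w := cyc_len cy.
Let p := cyc_proj cy.
Let x := cyc_x d cy.

(** The two dual iterates of step [j], after its projection and after its SHQP step; [post_shqp 0]
    is the input of the cycle. *)
Definition post_proj (j : nat) (i : 'I_m) : X := cyc_e cy (last_pos s j i) j.
Definition post_shqp (j : nat) (i : 'I_m) : X := cyc_e cy (last_pos s j i) j.+1.

Lemma cyc_xE j : x j = d - \sum_i post_shqp j i. Proof. by []. Qed.

Lemma post_shqp0 i : post_shqp 0 i = yin i.
Proof.
by rewrite /post_shqp last_pos0 ?(cycle_input spec)//; exact: cycle_s_init spec.
Qed.

Lemma post_proj_other j i : s j.+1%:Z != i -> post_proj j.+1 i = post_shqp j i.
Proof. by move=> sNi; rewrite /post_proj last_posS (negbTE sNi). Qed.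

Lemma post_proj_self j : (j < w)%N ->
  post_proj j.+1 (s j.+1%:Z) = x j + post_shqp j (s j.+1%:Z) - p j.+1.
Proof.
by move=> jw; rewrite /post_proj last_posS eqxx (proj_step_e (cycle_projection spec _)).
Qed.

(** The new block is [z_j] minus the projected point, so the projected point is itself the primal
    point of the dual iterate after the projection. *)
Lemma cyc_projE j : (j < w)%N -> p j.+1 = d - \sum_i post_proj j.+1 i.
Proof.
move=> jw; rewrite (bigD1 (s j.+1%:Z))//= post_proj_self// cyc_xE.
rewrite (bigD1 (s j.+1%:Z))//= [X in _ - (_ + X)](eq_bigr (post_shqp j)); last first.
  by move=> i iNs; rewrite post_proj_other// eq_sym.
set a := post_shqp j _; set b := \sum_(i | _) _.
rewrite [- (a + b)]opprD [d + (- a - b)]addrA [d - a - b + a]addrAC subrK.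
by rewrite [d - b - _ + b]addrAC subrK subKr.
Qed.

Lemma cyc_proj_in j : (j < w)%N -> C (s j.+1%:Z) (p j.+1).
Proof. by move=> jw; have [] := proj_stepP (cycle_projection spec (j := j.+1) jw). Qed.

Lemma cyc_proj_normal j q : (j < w)%N -> C (s j.+1%:Z) q ->
  ip (post_proj j.+1 (s j.+1%:Z)) (q - p j.+1) <= 0.
Proof.
move=> jw; have stepP := proj_stepP (cycle_projection spec (j := j.+1) jw).
rewrite post_proj_self//; apply: projection_variational stepP _ => //.
by move=> q' t Cq' t01; apply: Cconv => //; exact: cyc_proj_in.
Qed.

(** Normality at [p j.+1] bounds the new support value by the product with [p j.+1]; the old support
    value is at least its own such product. Expanding the squares leaves exactly the squared
    step. *)
Lemma dual_post_proj j : (j < w)%N ->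
  (dual_fun ip C d (post_proj j.+1) + (2^-1 * `|x j - p j.+1| ^+ 2)%:E
   <= dual_fun ip C d (post_shqp j))%E.
Proof.
move=> jw; set k := s j.+1%:Z.
rewrite /dual_fun -cyc_projE// -cyc_xE (bigD1 k)// [in leRHS](bigD1 k)//=.
rewrite [X in ((_ + (_ + X)) + _ <= _)%E]
    (eq_bigr (fun i => support_fun ip (post_shqp j i) (C i))); last first.
  by move=> i iNk; rewrite post_proj_other// eq_sym.
set E := (\sum_(i < m | _) _)%E.
have pk : (support_fun ip (post_proj j.+1 k) (C k) <=
    (ip (post_proj j.+1 k) (p j.+1))%:E)%E.
  apply: support_fun_le => q Cq; rewrite -subr_le0 -(ipBr ip).
  exact: cyc_proj_normal.
have bk := support_fun_ge ip (post_shqp j k) (cyc_proj_in jw).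
rewrite addeAC [leRHS]addeA addeA; apply: leeD => //.
apply: le_trans (leeD (lexx _) bk).
apply: (le_trans (leeD (lexx _) pk)).
rewrite -!EFinD lee_fin post_proj_self//.
set y := post_shqp j _; rewrite (ipBl ip) (ipDl ip) -norm_ip (normB_sqr norm_ip).
lra.
Qed.

(** Supports over [C] and [P] agree at the old blocks, and the one over [C] is the smaller at the
    new blocks, so the growth of the subproblem transfers to the dual function. *)
Lemma dual_post_shqp j : (j < w)%N ->
  (dual_fun ip C d (post_shqp j.+1) + (2^-1 * `|x j.+1 - p j.+1| ^+ 2)%:E
   <= dual_fun ip C d (post_proj j.+1))%E.
Proof.
move=> jw; have S := cycle_shqp spec (j := j.+1) jw.
set Q := cyc_Q cy j.+1; pose P i := cyc_P cy i j.+1.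
have keep i : i \notin Q -> post_shqp j.+1 i = post_proj j.+1 i.
  by move=> iQ; exact: shqp_keep S i iQ.
have P0 i : i \in Q -> P i 0 by move=> iQ; exact: shqp_sup S i iQ 0 (C0 i).
have g := block_obj_growth norm_ip (post_proj j.+1) P0 (shqp_min S).
rewrite !(dual_fun_split Q).
rewrite (eq_bigr (post_proj j.+1) keep).
rewrite [X in ((_ + X) + _ <= _)%E]
    (eq_bigr (fun i => support_fun ip (post_proj j.+1 i) (C i))); last first.
  by move=> i iQ; rewrite keep.
rewrite addeAC leeD2r//.
have -> : x j.+1 - p j.+1 =
    \sum_(i in Q) post_proj j.+1 i - \sum_(i in Q) post_shqp j.+1 i.
  rewrite cyc_xE cyc_projE// opprB addrC addrA subrK.
  rewrite (bigID (mem Q)) [X in _ - X](bigID (mem Q))/= opprD addrACA.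
  by rewrite [X in _ + (_ - X)](eq_bigr (post_proj j.+1) keep) subrr addr0.
apply: le_trans (le_trans g _).
  rewrite leeD2r// /block_obj leeD2l//; apply: lee_sum => i iQ.
  exact: support_fun_mono (shqp_sup S iQ).
rewrite /block_obj leeD2l//; apply: lee_sum => i iQ.
by rewrite -(shqp_support S iQ).
Qed.

(** Minimality is used twice: against zero blocks for finiteness, even when the dual value is
    infinite, and against the old blocks for the upper bound. *)
Lemma support_post_shqp j i : (j < w)%N -> i \in cyc_Q cy j.+1 ->
  (support_fun ip (post_shqp j.+1 i) (cyc_P cy i j.+1)
   <= dual_fun ip C d (post_proj j.+1))%E /\
  support_fun ip (post_shqp j.+1 i) (cyc_P cy i j.+1) \is a fin_num.
Proof.
move=> jw iQ; have S := cycle_shqp spec (j := j.+1) jw.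
set Q := cyc_Q cy j.+1 in iQ *; pose P i := cyc_P cy i j.+1.
have P0 k : k \in Q -> P k 0 by move=> kQ; exact: shqp_sup S k kQ 0 (C0 k).
pose q := d - \sum_(i | i \notin Q) post_proj j.+1 i.
have min u : (block_obj ip (mem Q) P q (post_shqp j.+1) <=
    block_obj ip (mem Q) P q u)%E.
  exact: shqp_min S u.
split; last first.
  apply: (block_obj_fin (q := q) P0) => //.
  by apply: le_lt_trans (min (fun=> 0)) _; exact: block_obj0_lty.
apply: (le_trans (support_le_block_obj (A := mem Q) ip q (post_shqp j.+1) P0 iQ)).
apply: (le_trans (min (post_proj j.+1))); rewrite (dual_fun_split Q).
apply: (@le_trans _ _ (block_obj ip (mem Q) C q (post_proj j.+1))).
  rewrite /block_obj leeD2l//; apply: lee_sum => k kQ.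
  by rewrite -(shqp_support S kQ).
by rewrite leeDl//; apply: sume_ge0 => k _; exact: support_fun_ge0.
Qed.

Lemma dual_post_proj_le j : (j < w)%N ->
  (dual_fun ip C d (post_proj j.+1) <= dual_fun ip C d (post_shqp j))%E.
Proof.
move=> jw; apply: le_trans (dual_post_proj jw).
by rewrite leeDl// lee_fin mulr_ge0.
Qed.

Lemma dual_post_shqp_le j : (j < w)%N ->
  (dual_fun ip C d (post_shqp j.+1) <= dual_fun ip C d (post_proj j.+1))%E.
Proof.
move=> jw; apply: le_trans (dual_post_shqp jw).
by rewrite leeDl// lee_fin mulr_ge0.
Qed.

Lemma dual_mono j k : (j <= k <= w)%N ->
  (dual_fun ip C d (post_shqp k) <= dual_fun ip C d (post_shqp j))%E.
Proof.
elim: k => [|k IH]; first by rewrite leqn0 => /andP[/eqP ->].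
move=> /andP[]; rewrite leq_eqVlt => /orP[/eqP <-//|jk kw].
apply: le_trans (dual_post_shqp_le kw) (le_trans (dual_post_proj_le kw) _).
by rewrite IH// -ltnS jk ltnW.
Qed.

Lemma dual_input : dual_fun ip C d (post_shqp 0) = dual_fun ip C d yin.
Proof.
rewrite /dual_fun; congr (_ + _)%E.
  by under eq_bigr do rewrite post_shqp0.
by apply: eq_bigr => i _; rewrite post_shqp0.
Qed.

Lemma dual_output : dual_fun ip C d (post_shqp w) = dual_fun ip C d yout.
Proof.
rewrite /dual_fun; congr (_ + _)%E.
  by under [in RHS]eq_bigr do rewrite (cycle_output spec).
by apply: eq_bigr => i _; rewrite (cycle_output spec).
Qed.

Section Steps.
Variables (vin vout : R).
Hypothesis vinE : dual_fun ip C d yin = vin%:E.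
Hypothesis voutE : dual_fun ip C d yout = vout%:E.

Lemma dual_decrease_le j : (j < w)%N ->
  2^-1 * `|x j - p j.+1| ^+ 2 <= vin - vout /\
  2^-1 * `|x j.+1 - p j.+1| ^+ 2 <= vin - vout.
Proof.
move=> jw.
have in_j : (dual_fun ip C d (post_shqp j) <= vin%:E)%E.
  by rewrite -vinE -dual_input dual_mono//= ltnW.
have out_j : (vout%:E <= dual_fun ip C d (post_shqp j.+1))%E.
  by rewrite -voutE -dual_output dual_mono//= jw leqnn.
have mid1 := dual_post_proj_le jw; have mid2 := dual_post_shqp_le jw.
have h1 := le_trans (dual_post_proj jw) in_j.
have h2 := le_trans (dual_post_shqp jw) (le_trans mid1 in_j).
split; rewrite lerBrDl -lee_fin EFinD.
  by apply: le_trans h1; rewrite leeD2r// (le_trans out_j mid2).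
by apply: le_trans h2; rewrite leeD2r.
Qed.

(** [D] bounds every half-step, and at most [2 w - 1] half-steps lead from a projected point to the
    final primal point. *)
Lemma dist_final (D : R) : 0 <= D -> D ^+ 2 = 2 * (vin - vout) ->
  forall j, (1 <= j <= w)%N -> `|p j - x w| <= (2 * w)%:R * D.
Proof.
move=> D0 D2.
have step (u : X) : 2^-1 * `|u| ^+ 2 <= vin - vout -> `|u| <= D.
  by move=> u2; rewrite -ler_sqr ?nnegrE// D2; lra.
have chain j k : (j + k < w)%N -> `|p j.+1 - x (j + k).+1| <= (2 * k + 1)%:R * D.
  elim: k => [|k IH].
    rewrite addn0 muln0 mul1r distrC => jw; apply: step.
    by case: (dual_decrease_le jw).
  rewrite addnS => jkw; have [s1 s2] := dual_decrease_le jkw.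
  have -> : p j.+1 - x (j + k).+2 = (p j.+1 - x (j + k).+1) +
      (x (j + k).+1 - p (j + k).+2) + (p (j + k).+2 - x (j + k).+2).
    by rewrite !subrKA.
  have -> : (2 * k.+1 + 1)%:R * D = (2 * k + 1)%:R * D + D + D.
    by rewrite mulnS -!natr1 !natrD; ring.
  rewrite (le_trans (ler_normD _ _))// lerD//; last by rewrite distrC step.
  by rewrite (le_trans (ler_normD _ _))// lerD// ?IH ?step// ltnW.
move=> [//|j] /andP[_ jw]; have := chain j (w - j.+1)%N.
have -> : (j + (w - j.+1) < w)%N by lia.
have -> : ((j + (w - j.+1)).+1 = w)%N by lia.
move=> /(_ isT)/le_trans; apply.
by rewrite ler_wpM2r// ler_nat; lia.
Qed.

End Steps.

End Cycle.

(** * Multipliers supported on active constraints *)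

Section Polyhedral.
Variables (R : realType) (X : completeNormedModType R) (ip : {dot X for idfun}).
Hypothesis norm_ip : forall x : X, `|x| ^+ 2 = ip x x.
Variables (m K : nat) (f : 'I_m -> 'I_K -> X) (c : 'I_m -> 'I_K -> \bar R) (d : X).
Let C := Cset ip f c.
Hypothesis C0 : forall i, C i 0.

Definition normal (a : 'I_m * 'I_K) : X := f a.1 a.2.
Definition bound (a : 'I_m * 'I_K) : \bar R := c a.1 a.2.

Lemma CsetP i q : C i q <->
  forall a, a.1 == i -> ((ip q (normal a))%:E <= bound a)%E.
Proof.
split=> [Cq [k r]/= /eqP ->|H r _]; first exact: Cq.
exact: (H (i, r)).
Qed.

Lemma Cset_conv i p q t : C i p -> C i q -> 0 <= t <= 1 -> C i (p + t *: (q - p)).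
Proof.
move=> /CsetP Cp /CsetP Cq t01; apply/CsetP => a ai.
have := Cp a ai; have := Cq a ai; case: (bound a) => [b||]//; rewrite ?leey//.
rewrite !lee_fin (ipDl ip) (ipZl ip) (ipBl ip) => qb pb.
have -> : ip p (normal a) + t * (ip q (normal a) - ip p (normal a)) =
  (1 - t) * ip p (normal a) + t * ip q (normal a) by ring.
have -> : b = (1 - t) * b + t * b by ring.
by have /andP[t0 t1] := t01; rewrite lerD// ler_wpM2l// subr_ge0.
Qed.

Variables (cy : shqp_cycle X m) (yin yout : 'I_m -> X).
Hypothesis spec : cycle_spec ip C d cy yin yout.
Hypothesis hs : uses_produced_halfspaces ip d cy.
Let s := cyc_s cy.
Let w := cyc_len cy.
Let p := cyc_proj cy.
Let x := cyc_x d cy.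
Let b j := post_shqp cy j.
Let v0 := dual_fun ip C d yin.

Lemma produced_normalE j : (j < w)%N ->
  cyc_z d cy j.+1 - p j.+1 = post_proj cy j.+1 (s j.+1%:Z).
Proof. by move=> jw; rewrite (post_proj_self spec). Qed.

Lemma produced_rep j : (j < w)%N -> exists mu : 'I_m * 'I_K -> R,
  [/\ forall a, 0 <= mu a,
    post_proj cy j.+1 (s j.+1%:Z) = \sum_a mu a *: normal a &
    forall a, mu a != 0 -> bound a = (ip (p j.+1) (normal a))%:E].
Proof.
move=> jw; have Cp := cyc_proj_in spec jw.
have [| |mu [mu0 muE mua]] := normal_cone_polyhedron norm_ip
    (A := fun a => a.1 == s j.+1%:Z) (F := normal) (c := bound) (p := p j.+1)
    (e := post_proj cy j.+1 (s j.+1%:Z)).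
- exact/CsetP.
- move=> q /CsetP Cq; rewrite -subr_le0 -(ipBl ip) (ipC ip).
  exact (cyc_proj_normal norm_ip Cset_conv spec jw Cq).
by exists mu; split => // a /mua[].
Qed.

Lemma ip_active_sum (la : 'I_m * 'I_K -> R) (q : X) :
  (forall a, la a != 0 -> bound a = (ip q (normal a))%:E) ->
  ip q (\sum_a la a *: normal a) = \sum_a la a * fine (bound a).
Proof.
move=> H; rewrite (scalar_fun_sum (ip_scalarr ip q)); apply: eq_bigr => a _.
by have [->|/H ->//] := eqVneq (la a) 0; rewrite !mul0r.
Qed.

(* [la] ranges over all constraints, not only over those of the block of [D]:
   the halfspaces defining [P_{i,j}] may come from projections onto other
   blocks. *)
Definition active_rep (j : nat) (u : X) (D : set X) (la : 'I_m * 'I_K -> R) :=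
  [/\ forall a, 0 <= la a, u = \sum_a la a *: normal a,
    forall a, la a != 0 -> exists l, (1 <= l <= j)%N /\
      bound a = (ip (p l) (normal a))%:E,
    (support_fun ip u D <= (\sum_a la a * fine (bound a))%:E)%E &
    ((\sum_a la a * fine (bound a))%:E <= v0)%E].

Lemma active_rep_leq j k u D la : (j <= k)%N -> active_rep j u D la -> active_rep k u D la.
Proof.
move=> jk [la0 uE act s1 s2]; split => // a /act[l [/andP[l1 lj] E]].
by exists l; rewrite l1 (leq_trans lj).
Qed.

Lemma dual_post_proj_input j : (j < w)%N ->
  (dual_fun ip C d (post_proj cy j.+1) <= v0)%E.
Proof.
move=> jw; apply: le_trans (dual_post_proj_le norm_ip Cset_conv spec jw) _.
rewrite /v0 -(dual_input spec).
by apply: (dual_mono norm_ip C0 Cset_conv spec); rewrite leq0n ltnW.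
Qed.

Lemma support_le_dual u i : (support_fun ip (u i) (C i) <= dual_fun ip C d u)%E.
Proof. exact: (support_le_block_obj ip d u (A := predT) (i := i)). Qed.

Lemma active_rep_proj j : (j < w)%N ->
  exists la, active_rep j.+1 (post_proj cy j.+1 (s j.+1%:Z)) (C (s j.+1%:Z)) la.
Proof.
move=> jw; have [mu [mu0 muE mua]] := produced_rep jw.
have muip : ip (post_proj cy j.+1 (s j.+1%:Z)) (p j.+1) = \sum_a mu a * fine (bound a).
  by rewrite (ipC ip) muE ip_active_sum.
exists mu; split => //.
- by move=> a /mua E; exists j.+1; rewrite leqnn.
- rewrite -muip; apply: support_fun_le => q Cq; rewrite -subr_le0 -(ipBr ip).
  exact: (cyc_proj_normal norm_ip Cset_conv spec jw Cq).
- rewrite -muip; apply: le_trans (dual_post_proj_input jw).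
  apply: le_trans (support_fun_ge _ _ (cyc_proj_in spec jw)) _.
  exact: support_le_dual.
Qed.

(** [P] is cut out by halfspaces with normals [e l], tight at [p l.+1]. Farkas' lemma writes the new
    block as a nonnegative combination of the [e l], and each [e l] expands over constraints active
    at its own projected point. *)
Lemma active_rep_shqp j i : (j < w)%N -> i \in cyc_Q cy j.+1 ->
  exists la, active_rep j.+1 (b j.+1 i) (C i) la.
Proof.
move=> jw iQ; have [|J [Jj PE]] := hs _ iQ; first by rewrite jw.
have S := cycle_shqp spec (j := j.+1) jw.
have [sup_le sup_fin] := support_post_shqp C0 spec jw iQ.
pose e (l : 'I_j.+1) := post_proj cy l.+1 (s l.+1%:Z).
pose A (l : 'I_j.+1) := `[< J l.+1 >].
have lw (l : 'I_j.+1) : (l < w)%N by apply: leq_trans (ltn_ord l) jw.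
have PP q : cyc_P cy i j.+1 q <-> forall l, A l -> ip q (e l) <= ip (p l.+1) (e l).
  rewrite PE; split => [H l /asboolP Jl|H [|l] Jl].
  - have := H _ Jl; rewrite /produced_halfspace/= (produced_normalE (lw l)).
    by rewrite (ipC ip) (ipBl ip) subr_le0.
  - by have := Jj _ Jl.
  - have lj : (l < j.+1)%N by have /andP[] := Jj _ Jl.
    rewrite /produced_halfspace/= (produced_normalE (lw (Ordinal lj))).
    rewrite (ipC ip) (ipBl ip) subr_le0; apply: (H (Ordinal lj)).
    exact/asboolP.
(* The finite support value over [P] is the right-hand side, so it bounds the weighted offsets of
   the combination. *)
have [|q /PP Pq|t [t0 tA tE tb]] := @farkas_ip _ _ ip norm_ip _ A e
    (fun l => ip (p l.+1) (e l)) (b j.+1 i)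
    (fine (support_fun ip (b j.+1 i) (cyc_P cy i j.+1))).
- by exists 0; apply/PP; exact: shqp_sup S i iQ 0 (C0 i).
- by rewrite -lee_fin fineK// (ipC ip); exact: support_fun_ge.
have /choice[mu muP] : forall l : 'I_j.+1, exists mu : 'I_m * 'I_K -> R,
    [/\ forall a, 0 <= mu a, e l = \sum_a mu a *: normal a &
    forall a, mu a != 0 -> bound a = (ip (p l.+1) (normal a))%:E].
  by move=> l; exact: produced_rep (lw l).
pose la a := \sum_l t l * mu l a.
have laE : \sum_a la a * fine (bound a) = \sum_l t l * ip (p l.+1) (e l).
  under eq_bigr do rewrite mulr_suml.
  rewrite exchange_big/=; apply: eq_bigr => l _; have [_ eE act] := muP l.
  by rewrite eE ip_active_sum// mulr_sumr; apply: eq_bigr => a _; rewrite mulrA.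
exists la; split.
- by move=> a; apply: sumr_ge0 => l _; have [mu0 _ _] := muP l; rewrite mulr_ge0.
- rewrite tE; under [RHS]eq_bigr do rewrite scaler_suml.
  rewrite exchange_big/=; apply: eq_bigr => l _; have [_ -> _] := muP l.
  by rewrite scaler_sumr; apply: eq_bigr => a _; rewrite scalerA.
- move=> a laa; have [l /andP[_ tmu]] : exists l, true && (t l * mu l a != 0).
    apply/existsP; apply: contraR laa; rewrite negb_exists => /forallP H.
    by rewrite /la big1// => l _; apply/eqP; have := H l; rewrite negbK.
  exists l.+1; split; first by rewrite ltn_ord.
  have [_ _ act] := muP l; apply: act.
  by apply: contraNneq tmu => ->; rewrite mulr0.
- rewrite laE; apply: support_fun_le => q /(shqp_sup S iQ)/PP Pq.
  rewrite (ipC ip) tE (scalar_fun_sum (ip_scalarr ip q)).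
  apply: ler_sum => l _; have [Al|/tA ->] := boolP (A l); last by rewrite !mul0r.
  by rewrite ler_wpM2l// Pq.
- rewrite laE; apply: le_trans (dual_post_proj_input jw); apply: le_trans sup_le.
  by rewrite -lee_fin fineK// in tb.
Qed.

(** After its first visit a block changes only by projections and SHQP steps, which both produce
    representations. The input block may have none, hence the visit condition. *)
Lemma active_rep_visited j i : (j <= w)%N ->
  (exists l, (1 <= l <= j)%N /\ s l%:Z = i) ->
  exists la, active_rep j (b j i) (C i) la.
Proof.
elim: j => [|j IH] jw [l [lj si]]; first by move: lj; case: l si.
have [iQ|iQ] := boolP (i \in cyc_Q cy j.+1); first exact: active_rep_shqp.
have -> : b j.+1 i = post_proj cy j.+1 i.
  exact: (shqp_keep (cycle_shqp spec (j := j.+1) jw) iQ).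
have [<-|sNi] := eqVneq (s j.+1%:Z) i; first exact: active_rep_proj.
rewrite post_proj_other//; have [||la laP] := IH; [exact: ltnW| |].
  exists l; split => //; move: lj => /andP[-> /=]; rewrite leq_eqVlt.
  by move=> /orP[/eqP lj|//]; rewrite -lj si eqxx in sNi.
by exists la; exact: active_rep_leq laP.
Qed.

Lemma active_rep_output i : exists la, active_rep w (yout i) (C i) la.
Proof.
rewrite (cycle_output spec); apply: active_rep_visited => //.
by have [l lP] := cycle_s_onto spec i; exists l.
Qed.

(** The input value may be infinite: a representation bounds each support value by a real number in
    any case. *)
Lemma dual_output_lty : (dual_fun ip C d yout < +oo)%E.
Proof.
rewrite /dual_fun lte_add_pinfty ?ltry// lte_sum_pinfty// => i _.
by have [la [_ _ _ laC _]] := active_rep_output i; rewrite (le_lt_trans laC)// ltry.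
Qed.

End Polyhedral.

(** * Linear convergence *)

Section Lifted.
Variables (R : realType) (X : completeNormedModType R) (ip : {dot X for idfun}).
Hypothesis norm_ip : forall x : X, `|x| ^+ 2 = ip x x.

Lemma sum_scale_pair (I : finType) (la : I -> R) (F : I -> X) (r : I -> R) :
  \sum_a la a *: ((F a, r a) : X * R^o) =
  (\sum_a la a *: F a, \sum_a la a * r a).
Proof.
by elim/big_rec3 : _ => [|a y1 y2 y3 _ ->].
Qed.

Lemma norm_pairE (u : X) (r : R) :
  `|(u, r) : X * R^o| = Num.max `|u| `|r|.
Proof. by []. Qed.

Lemma bounded_coefficients_lifted : bounded_coefficients (X * R^o)%type.
Proof.
move=> I g; pose B (y z : X * R^o) := ip y.1 z.1 + (y.2 : R) * z.2.
have n1 (y : X * R^o) : `|y.1| <= `|y| by rewrite /Num.norm/= le_max lexx.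
have n2 (y : X * R^o) : `|y.2| <= `|y| by rewrite /Num.norm/= le_max lexx orbT.
apply: (@gram_bound _ _ B 2) => //.
- move=> z a [u r] [v t]; rewrite /B/= (ipDl ip) (ipZl ip) /GRing.scale/=; ring.
- move=> z a [u r] [v t]; rewrite /B/= (ipDr ip) (ipZr ip) /GRing.scale/=; ring.
- move=> [u r]; rewrite /B/= -norm_ip -expr2 => /eqP.
  by rewrite paddr_eq0 ?sqr_ge0// !sqrf_eq0 normr_eq0 => /andP[/eqP -> /eqP ->].
- move=> y z; rewrite (le_trans (ler_normD _ _))// mulr2n mulrDl mulrDl mul1r.
  rewrite lerD//; last by rewrite normrM ler_pM.
  by rewrite (le_trans (ip_normr norm_ip _ _))// ler_pM.
Qed.

End Lifted.

Lemma contraction_factor (R : realFieldType) (K0 u v : R) : 0 <= K0 ->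
  v <= K0 * (u - v) -> v <= K0 / (1 + K0) * u.
Proof.
move=> K00 H; rewrite mulrAC ler_pdivlMr; last by lra.
lra.
Qed.

(** Optimality of multipliers is a single equation in [X * R^o]: the pairs of normals and offsets
    must combine to [(d, 0)]. The error bound is applied there, with a constant fixed before the
    cycle, so [rho] is common to all cycles considered. *)
Lemma cycle_contraction (R : realType) (X : completeNormedModType R)
    (ip : {dot X for idfun}) (norm_ip : forall x : X, `|x| ^+ 2 = ip x x)
    (m K : nat) (f : 'I_m -> 'I_K -> X) (c : 'I_m -> 'I_K -> \bar R)
    (f_unit : forall i r, `|f i r| = 1) (d : X)
    (projCd : is_projection (Cinter ip f c) d 0) (V : R) (wmax : nat) :
  exists2 rho : R, 0 <= rho < 1 &
  forall (cy : shqp_cycle X m) (yin yout : 'I_m -> X),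
    cycle_spec ip (Cset ip f c) d cy yin yout ->
    uses_produced_halfspaces ip d cy -> (cyc_len cy <= wmax)%N ->
    (dual_fun ip (Cset ip f c) d yin <= V%:E)%E ->
    (dual_fun ip (Cset ip f c) d yout
      <= rho%:E * dual_fun ip (Cset ip f c) d yin)%E.
Proof.
have [CI0 dmin] := projCd.
have C0 i : Cset ip f c i 0 by exact: CI0.
pose F := normal f; pose cc := bound c.
have c_ge0 a : (0%:E <= cc a)%E.
  by have := C0 a.1 a.2 I; rewrite /halfspace/= (ip0l ip).
have fc_ge0 a : 0 <= fine (cc a) by rewrite fine_ge0.
(* As 0 is the projection of [d], [d] is normal to the intersection at 0; its multipliers [la0] are
   dual optimal. *)
have [| |la0 [la00 dE la0act]] := normal_cone_polyhedron norm_ip (A := predT)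
    (F := F) (c := cc) (p := 0) (e := d).
- by move=> a _; rewrite (ip0l ip).
- move=> q Hq; rewrite (ip0l ip) (ipC ip).
  have CIq : Cinter ip f c q by move=> i _; apply/CsetP => a _; exact: Hq.
  have := projection_variational norm_ip _ projCd CIq; rewrite !subr0; apply.
  by move=> q' t Cq' t01 i _; apply: Cset_conv t01 => //; exact: Cq'.
have {}la0act a : la0 a != 0 -> cc a = 0%:E.
  by move=> /la0act[_ ->]; rewrite (ip0l ip).
pose g a : X * R^o := (F a, fine (cc a)).
pose h : X * R^o := (d, 0).
have la0h : \sum_a la0 a *: g a = h.
  rewrite sum_scale_pair -dE big1// => a _.
  by have [->|/la0act ->] := eqVneq (la0 a) 0; rewrite ?mul0r ?mulr0.
pose mV := m%:R * V.
(* The radius adds the bounds [1 + 2 * V] on the norm of [x] and [mV] on the weighted offsets [Xi]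
   to the norm of [h]. *)
have [ka ka0 kaP] := error_bound (bounded_coefficients_lifted norm_ip)
  (1 + 2 * V + mV + `|h|) la00 la0h.
(* The 2 comes from [D ^+ 2], the square from the path length and the error bound, the last factor
   from [res2]. *)
pose K0 := 2 * ((2 * wmax)%:R * ka) ^+ 2 * (2 + `|mV|).
have K00 : 0 <= K0 by rewrite !mulr_ge0 ?sqr_ge0// addr_ge0.
exists (K0 / (1 + K0)).
  rewrite divr_ge0 ?addr_ge0//= ltr_pdivrMr ?mul1r; last by lra.
  by rewrite ltrDr.
move=> cy yin yout spec hs wle inV.
have vin_fin : dual_fun ip (Cset ip f c) d yin \is a fin_num.
  by rewrite ge0_fin_numE ?dual_fun_ge0// (le_lt_trans inV)// ltry.
have vout_fin : dual_fun ip (Cset ip f c) d yout \is a fin_num.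
  by rewrite ge0_fin_numE ?dual_fun_ge0// (dual_output_lty norm_ip C0 spec hs).
have vinE := esym (fineK vin_fin); have voutE := esym (fineK vout_fin).
set vin := fine _ in vinE; set vout := fine _ in voutE.
have Cconv := @Cset_conv _ _ ip _ _ f c.
have out_in : vout <= vin.
  rewrite -lee_fin -vinE -voutE -(dual_input spec) -(dual_output spec).
  by apply: (dual_mono norm_ip C0 Cconv spec); rewrite leqnn.
have vinV : vin <= V by rewrite -lee_fin -vinE.
have vout0 : 0 <= vout by rewrite -lee_fin -voutE dual_fun_ge0.
rewrite vinE voutE -EFinM lee_fin; apply: contraction_factor => //.
have /choice[la laP] : forall i, exists la,
    active_rep ip f c d cy yin (cyc_len cy) (yout i) (Cset ip f c i) la.
  by move=> i; exact: (active_rep_output norm_ip C0 spec hs).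
pose w := cyc_len cy; pose x := cyc_x d cy w.
have xE : x = d - \sum_i yout i.
  by rewrite /x cyc_xE; congr (_ - _); apply: eq_bigr => i _; rewrite (cycle_output spec).
pose L a := \sum_i la i a.
have L0 a : 0 <= L a by apply: sumr_ge0 => i _; have [la0' _ _ _ _] := laP i.
have LF : \sum_a L a *: F a = d - x.
  rewrite xE subKr; under eq_bigr do rewrite scaler_suml.
  by rewrite exchange_big/=; apply: eq_bigr => i _; have [_ -> _ _ _] := laP i.
pose Xi := \sum_a L a * fine (cc a).
have XiE : Xi = \sum_i \sum_a la i a * fine (cc a).
  by rewrite exchange_big/=; apply: eq_bigr => a _; rewrite mulr_suml.
have Xi0 : 0 <= Xi by apply: sumr_ge0 => a _; rewrite mulr_ge0.
have XimV : Xi <= mV.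
  rewrite XiE (le_trans (_ : _ <= \sum_(i < m) V))//; last first.
    by rewrite sumr_const card_ord -mulr_natl.
  apply: ler_sum => i _; have [_ _ _ _ H] := laP i.
  by rewrite -lee_fin (le_trans H).
have Lact a : L a != 0 -> exists l, (1 <= l <= w)%N /\
    cc a = (ip (cyc_proj cy l) (F a))%:E.
  move=> La; have [i lai] : exists i, la i a != 0.
    apply/existsP; apply: contraR La; rewrite negb_exists => /forallP H.
    by rewrite /L big1// => i _; apply/eqP; have := H i; rewrite negbK.
  by have [_ _ H _ _] := laP i; exact: H.
pose vt := 2^-1 * `|x| ^+ 2 + Xi.
have vt0 : 0 <= vt by rewrite addr_ge0// mulr_ge0.
have vout_vt : vout <= vt.
  rewrite -lee_fin -voutE /dual_fun -xE EFinD leeD2l//.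
  rewrite XiE -sumEFin; apply: lee_sum => i _.
  by have [_ _ _ H _] := laP i.
have x2V : 2^-1 * `|x| ^+ 2 <= V.
  rewrite (le_trans _ (le_trans out_in vinV))// -lee_fin -voutE /dual_fun -xE.
  by rewrite leeDl//; apply: sume_ge0 => i _; exact: support_fun_ge0.
have xV : `|x| <= 1 + 2 * V by have := sqr_ge0 (`|x| - 1); have := normr_ge0 x; nra.
have resE : \sum_a L a *: g a - h = (- x, Xi).
  by rewrite sum_scale_pair LF /h; congr (_, _); rewrite /= ?subr0// addrAC subrr add0r.
have res_le : `|\sum_a L a *: g a - h| <= `|x| + Xi.
  rewrite resE norm_pairE normrN (ger0_norm Xi0).
  by rewrite ge_max lerDl Xi0 lerDr normr_ge0.
have res2 : `|\sum_a L a *: g a - h| ^+ 2 <= (2 + `|mV|) * vt.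
  have : `|\sum_a L a *: g a - h| ^+ 2 <= `|x| ^+ 2 + Xi ^+ 2.
    rewrite resE norm_pairE normrN (ger0_norm Xi0).
    by case: (leP `|x| Xi) => _; rewrite ?lerDl ?lerDr sqr_ge0.
  have : Xi ^+ 2 <= `|mV| * vt.
    rewrite expr2; apply: ler_pM => //; first exact: le_trans XimV (ler_norm _).
    by rewrite /vt lerDr mulr_ge0.
  rewrite /vt; nra.
have LM : `|\sum_a L a *: g a| <= 1 + 2 * V + mV + `|h|.
  rewrite -[\sum_a _](subrK h) (le_trans (ler_normD _ _))// lerD2r.
  by rewrite (le_trans res_le)// lerD.
(* [la'] has the same lifted sum as [L], so [x], [Xi] and [vt] are unchanged by the replacement. *)
have [la' [las [[la'0 la'L la'g] [las0 lasL lash Tle]]]] := kaP L L0 LM.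
have la'F : \sum_a la' a *: F a = d - x.
  by rewrite -LF; move: la'g; rewrite !sum_scale_pair => -[].
have la'c : \sum_a la' a * fine (cc a) = Xi.
  by move: la'g; rewrite !sum_scale_pair => -[].
have [lasF lasc] : \sum_a las a *: F a = d /\ \sum_a las a * fine (cc a) = 0.
  by move: lash; rewrite sum_scale_pair => -[].
pose D := Num.sqrt (2 * (vin - vout)).
have D2 : D ^+ 2 = 2 * (vin - vout) by rewrite sqr_sqrtr// mulr_ge0// subr_ge0.
pose S := (2 * wmax)%:R * D.
have S0 : 0 <= S by rewrite mulr_ge0 ?sqrtr_ge0.
have distS l : (1 <= l <= w)%N -> `|cyc_proj cy l - x| <= S.
  move=> lw.
  apply: (le_trans (dist_final norm_ip C0 Cconv spec vinE voutE (sqrtr_ge0 _) D2 lw)).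
  by rewrite ler_wpM2r ?sqrtr_ge0// ler_nat leq_mul2l.
have ipS l a : (1 <= l <= w)%N -> `|ip (cyc_proj cy l) (F a) - ip x (F a)| <= S.
  move=> lw; rewrite -(ipBl ip) (le_trans (ip_normr norm_ip _ _))//.
  by rewrite /F /normal f_unit mulr1 distS.
have slackL a : L a != 0 -> `|fine (cc a) - ip x (F a)| <= S.
  by move=> /Lact[l [lw ->]]; exact: ipS.
(* Some step projects onto the block of [a], and its projected point satisfies the constraint; this
   gives only a lower bound. *)
have slackN a : cc a \is a fin_num -> - S <= fine (cc a) - ip x (F a).
  move=> cfin; have [l [lw sl]] := cycle_s_onto spec a.1.
  have := ipS l a lw; rewrite ler_norml => /andP[+ _]; move=> /le_trans; apply.
  rewrite lerD2r -lee_fin fineK//.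
  have [l' E] : exists l', l = l'.+1 by case: l lw {sl} => // l' _; exists l'.
  have := cyc_proj_in spec (j := l'); rewrite -E => /(_ _).
  rewrite sl => H; apply: (CsetP ip f c a.1 _).1 => //; apply: H.
  by have /andP[_] := lw; rewrite E.
have vt_le : vt <= S * \sum_a `|la' a - las a|.
  (* This sum equals the squared norm of [x] plus [Xi], which is at least [vt]. *)
  apply: (@le_trans _ _ (\sum_a (la' a - las a) * (fine (cc a) - ip x (F a)))).
    have -> : \sum_a (la' a - las a) * (fine (cc a) - ip x (F a)) =
        \sum_a la' a * fine (cc a) - \sum_a las a * fine (cc a)
        - (ip x (\sum_a la' a *: F a) - ip x (\sum_a las a *: F a)).
      rewrite !(scalar_fun_sum (ip_scalarr ip x)) -!sumrB.
      by apply: eq_bigr => a _; ring.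
    rewrite la'c lasc la'F lasF (ipBr ip) -norm_ip /vt.
    by have := sqr_ge0 `|x|; lra.
  rewrite mulr_sumr; apply: ler_sum => a _.
  (* Where [L a] is nonzero the slack is bounded on both sides. Elsewhere [la' a = 0] and
     [las a >= 0], so the lower bound suffices. *)
  have [La0|La] := eqVneq (L a) 0; last first.
    rewrite (le_trans (ler_norm _))// normrM mulrC ler_wpM2r//.
    exact: slackL.
  rewrite la'L// sub0r normrN (ger0_norm (las0 a)) mulNr.
  have [->|lasa] := eqVneq (las a) 0; first by rewrite mul0r mulr0 oppr0.
  (* Off the support of [L], [las] is nonzero only where [la0] is, and there the bound is 0. *)
  have cfin : cc a \is a fin_num.
    rewrite la0act//; apply: contra_neq lasa => la0a; exact: lasL.
  by rewrite -mulrN mulrC ler_wpM2r// lerNl slackN.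
have vt_res : vt <= S * ka * `|\sum_a L a *: g a - h|.
  by rewrite (le_trans vt_le)// -mulrA ler_wpM2l.
(* The squared residual is at most a multiple of [vt], so after squaring one factor [vt] cancels. *)
have vt2 : vt * vt <= K0 * (vin - vout) * vt.
  rewrite -expr2; apply: (@le_trans _ _ ((S * ka * `|\sum_a L a *: g a - h|) ^+ 2)).
    by rewrite ler_sqr ?nnegrE// (le_trans vt0).
  rewrite exprMn exprMn (le_trans (ler_wpM2l _ res2))//.
    by rewrite mulr_ge0 ?sqr_ge0.
  by rewrite /S exprMn D2 /K0 le_eqVlt; apply/orP; left; apply/eqP; ring.
apply: (le_trans vout_vt); move: vt0; rewrite le_eqVlt => /orP[/eqP <-|vt_gt0].
  by rewrite mulr_ge0// subr_ge0.
by move: vt2; rewrite ler_pM2r.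
Qed.

Theorem proposition7p4 (R : realType) (X : completeNormedModType R)
    (ip : {dot X for idfun}) (norm_ip : forall x : X, `|x| ^+ 2 = ip x x)
    (m K : nat) (f : 'I_m -> 'I_K -> X) (c : 'I_m -> 'I_K -> \bar R)
    (f_unit : forall i r, `|f i r| = 1)
    (c_notNy : forall i r, c i r != -oo%E)
    (C_nonempty : Cinter ip f c !=set0)
    (d : X) (projCd : is_projection (Cinter ip f c) d 0)
    (y : nat -> 'I_m -> X) (cyc : nat -> shqp_cycle X m)
    (run : forall k : nat, (1 <= k)%N ->
       cycle_spec ip (Cset ip f c) d (cyc k) (y k.-1) (y k))
    (halfspaces : forall k : nat, (1 <= k)%N ->
       uses_produced_halfspaces ip d (cyc k))
    (bounded : exists w : nat, forall k : nat, (1 <= k)%N ->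
       (cyc_len (cyc k) <= w)%N) :
  exists (delta2 : R) (kbar : nat) (rho : R),
    [/\ 0 < delta2, (0 < kbar)%N, 0 <= rho & rho < 1] /\
    (forall k : nat, (1 <= k)%N -> (k < kbar)%N ->
       (dual_fun ip (Cset ip f c) d (y k)
          < dual_fun ip (Cset ip f c) d (y k.-1) - delta2%:E)%E) /\
    (forall k : nat, (1 <= k)%N -> (kbar < k)%N ->
       (dual_fun ip (Cset ip f c) d (y k)
          <= rho%:E * dual_fun ip (Cset ip f c) d (y k.-1))%E).
Proof.
have [w wP] := bounded.
have C0 i : Cset ip f c i 0 by have [CI0 _] := projCd; exact: CI0.
pose v k := dual_fun ip (Cset ip f c) d (y k).
have v1_fin : v 1%N \is a fin_num.
  rewrite ge0_fin_numE ?dual_fun_ge0//.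
  exact: (dual_output_lty norm_ip C0 (run 1%N isT) (halfspaces 1%N isT)).
(* The value after the first cycle is finite and, by monotonicity, bounds the input of every later
   cycle. *)
have [rho /andP[rho0 rho1] rhoP] :=
  cycle_contraction norm_ip f_unit projCd (fine (v 1%N)) w.
have v_le k : (v k.+1 <= v 1%N)%E.
  elim: k => // k IH; apply: le_trans IH.
  have spec := run k.+2 isT; rewrite /v -(dual_output spec) -[leRHS](dual_input spec).
  apply: (dual_mono norm_ip C0 _ spec); last by rewrite leqnn.
  exact: Cset_conv.
(* With [kbar = 1], (A) concerns no [k >= 1], so any positive [delta2] will do; (B) starts with the
   second cycle. *)
exists 1, 1%N, rho; split; first by split.
split=> [[|[]]//|[|[|k]]// _ _].
apply: rhoP; [exact: run|exact: halfspaces|exact: wP|].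
by rewrite fineK//; exact: v_le.
Qed.
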